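(* Fix $z_0>0$ and $t>0$. For $\varepsilon>0$, let $\mathcal{U}(\varepsilon)\subset\mathcal{H}$ be the set of $\vartheta=(r_k,\phi_k)_{k\in\mathbb{Z}}\in\mathcal{H}$ satisfying $$r_k^*\le r_k\le r_k^*+\varepsilon^{2/5}\quad\text{for all }|k|\le-\frac1b\log\Big(\frac{2\sum_{j\in\mathbb{Z}}c_j^2}{z_0}\,\varepsilon^{9/10}\Big),$$ $$|\phi_k-\phi_k^*|\le\varepsilon\quad\text{for all }|k|\le\varepsilon^{-1/2}\text{ except }k=0,1,$$ where $r_k^*$ and $\phi_k^*=\phi_k^*(\phi_0,\phi_1)$ are defined in the context. Then $\mathcal{U}(\varepsilon)$ satisfies the large deviations principle $$\lim_{\varepsilon\to0^+}\varepsilon\log\mathbb{P}(\mathcal{U}(\varepsilon))=-\frac{z_0^2}{\sum_{k\in\mathbb{Z}}c_k^2}.$$ Moreover, $\mathcal{U}(\varepsilon)$ is almost entirely contained in $\mathcal{D}(t,z_0\varepsilon^{-1/2}-\varepsilon)$, in the following sense: there exist constants $c,C>0$ and $\varepsilon_0>0$ such that for all $0<\varepsilon<\varepsilon_0$ $$\log\mathbb{P}\big(\mathcal{U}(\varepsilon)\setminus\mathcal{D}(t,z_0\varepsilon^{-1/2}-\varepsilon)\big)\le-C\exp(c\,\varepsilon^{-1/2}).$$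
   Context: Coefficients: $c_k=a\,e^{-b|k|}$ for all $k\in\mathbb{Z}$, or $c_k=a\,e^{-b|k|^2}$ for all $k\in\mathbb{Z}$, with $a,b>0$ fixed. Parameter space: $\mathcal{H}=\{(r_k,\phi_k)_{k\in\mathbb{Z}}: r_k\ge0,\ \phi_k\in[0,2\pi)\}$, endowed with the product probability measure $\mathbb{P}$ under which all $r_k,\phi_k$ are independent, $\phi_k$ is uniform on $[0,2\pi)$ and $r_k$ is Rayleigh distributed with parameter $1/\sqrt2$ (density $2re^{-r^2}$ on $[0,\infty)$); equivalently, the $r_ke^{i\phi_k}$ are independent complex Gaussians $\eta_k$ with $\mathbb{E}\eta_k=0$, $\mathbb{E}\eta_k^2=0$, $\mathbb{E}|\eta_k|^2=1$. Solution: $u(t,x\mid\vartheta)=\sum_{k\in\mathbb{Z}}c_kr_ke^{ikx+i\phi_k-ik^2t}$ is the solution of the linear Schr\''odinger equation $i\partial_tu+\Delta u=0$ on $\mathbb{T}=[0,2\pi]$ with datum $u_0(x\mid\vartheta)=\sum_kc_kr_ke^{ikx+i\phi_k}$. For $z>0$, $\mathcal{D}(t,z)=\{\vartheta\in\mathcal{H}:\sup_{x\in\mathbb{T}}|u(t,x\mid\vartheta)|>z\}$. Minimizers: $r_k^*=\dfrac{c_kz_0\varepsilon^{-1/2}}{\sum_{j\in\mathbb{Z}}c_j^2}$ and $\phi_k^*=\phi_0^*-kx^*+k^2t\pmod{2\pi}$, where, given $(\phi_0,\phi_1)$, one takes $\phi_0^*=\phi_0$ and $x^*\in\mathbb{T}$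 determined by $\phi_1+x^*-t=\phi_0\pmod{2\pi}$ (so that $\phi_1^*=\phi_1$); thus $\phi_k^*=\phi_k^*(\phi_0,\phi_1)$ is a function of $\phi_0,\phi_1$. Representatives modulo $2\pi$ are taken in $[0,2\pi)$. *)

(* Defs.v *)
From HB Require Import structures.
From mathcomp Require Import all_boot all_order all_algebra.
From mathcomp Require Import all_classical all_reals all_analysis.
From mathcomp Require Import complex.

Set Implicit Arguments.
Unset Strict Implicit.
Unset Printing Implicit Defensive.

Import Order.TTheory GRing.Theory Num.Theory.
Import numFieldNormedType.Exports.

Local Open Scope classical_set_scope.
Local Open Scope ring_scope.

Section ParameterSpace.
Variable R : realType.

Definition coord_cylinders : set (set (int -> R * R)) :=
  [set A | exists (k : int) (B : set (R * R)),
     measurable B /\ A = (fun th => th k) @^-1` B].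

(* The ambient space of all families (r_k, phi_k) of pairs of reals, with the
   product sigma-algebra; the constraints r_k >= 0 and phi_k \in [0, 2 pi) are
   imposed by [paramH], which has full measure under a [param_law]. *)
Local Notation param_space := (g_sigma_algebraType coord_cylinders).

Definition ampl (th : param_space) (k : int) : R := (th k).1.
Definition phase (th : param_space) (k : int) : R := (th k).2.

Definition paramH : set param_space :=
  [set th | forall k, 0 <= ampl th k /\ 0 <= phase th k < 2 * pi].

Definition rayleigh_pdf (r : R) : R :=
  if 0 <= r then 2 * r * expR (- r ^+ 2) else 0.

Definition rayleigh_law (A : set R) : \bar R :=
  (\int[lebesgue_measure]_(r in A) (rayleigh_pdf r)%:E)%E.

Lemma lt0_2pi : (0 : R) < 2 * pi.
Proof. by rewrite mulr_gt0 ?ltr0n ?pi_gt0. Qed.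

(* [uniform_prob] is uniform on the closed interval [0, 2 pi]; the endpoint is
   negligible. *)
Definition phase_law : set R -> \bar R := uniform_prob lt0_2pi.

(* P is the product probability measure: by uniqueness of measure extension it
   is determined by its values on the finite-dimensional measurable
   rectangles. *)
Definition param_law (P : probability param_space R) : Prop :=
  forall (s : seq int) (A B : int -> set R),
    uniq s ->
    (forall k, measurable (A k)) -> (forall k, measurable (B k)) ->
    P [set th | forall k, k \in s -> A k (ampl th k) /\ B k (phase th k)]
    = (\prod_(k <- s) (rayleigh_law (A k) * phase_law (B k)))%E.

End ParameterSpace.

Arguments coord_cylinders R : clear implicits.
Notation param_space R := (g_sigma_algebraType (coord_cylinders R)).

Section Solution.
Variable R : realType.
Implicit Types (c f : int -> R) (th : param_space R).

(* Sum over all integers, as the limit of the symmetric partial sums; it is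
   only used for absolutely summable families, for which the order of summation
   is irrelevant. *)
Definition zsum f : R :=
  limn (fun N : nat => \sum_(i < N.*2.+1) f (i%:Z - N%:Z)).

Definition zsumC (f : int -> R[i]) : R[i] :=
  Complex (zsum (fun k => complex.Re (f k))) (zsum (fun k => complex.Im (f k))).

Definition expi (y : R) : R[i] := Complex (cos y) (sin y).

Definition sol c (t x : R) th : R[i] :=
  zsumC (fun k => real_complex R (c k * ampl th k) *
                  expi (k%:~R * x + phase th k - (k%:~R) ^+ 2 * t)).

(* The family of terms of [sol] is summable (for one, equivalently all, t, x):
   the moduli of the terms are c_k r_k.  This holds almost surely. *)
Definition sol_defined c th : Prop :=
  summable [set: int] (fun k => (c k * ampl th k)%:E).

(* Parameters at which the series does not converge define no solution and do
   not belong to [calD]. *)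
Definition calD c (t z : R) : set (param_space R) :=
  [set th | [/\ paramH th, sol_defined c th &
     (z%:E < ereal_sup ((fun x => (complex.Re `|sol c t x th|)%:E)
                          @` `[0%R, (2 * pi)%R]))%E]].

End Solution.

Section Minimizers.
Variable R : realType.
Implicit Types (c : int -> R) (th : param_space R).

Definition mod2pi (y : R) : R :=
  y - 2 * pi * (Num.floor (y / (2 * pi)))%:~R.

Definition ampl_star c (z0 e : R) (k : int) : R :=
  c k * z0 * e `^ (- (1 / 2)) / zsum (fun j => c j ^+ 2).

(* x^* solves phi_1 + x^* - t = phi_0 modulo 2 pi. *)
Definition x_star (t : R) (phi0 phi1 : R) : R := mod2pi (phi0 - phi1 + t).

Definition phase_star (t : R) (phi0 phi1 : R) (k : int) : R :=
  mod2pi (phi0 - k%:~R * x_star t phi0 phi1 + (k%:~R) ^+ 2 * t).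

Definition calU c (b z0 t e : R) : set (param_space R) :=
  [set th | [/\ paramH th,
    (forall k : int,
       `|k|%:~R <= - (1 / b) * ln (2 * zsum (fun j => c j ^+ 2) / z0
                                   * e `^ (9 / 10)) ->
       ampl_star c z0 e k <= ampl th k <= ampl_star c z0 e k + e `^ (2 / 5)) &
    (forall k : int,
       `|k|%:~R <= e `^ (- (1 / 2)) -> k != 0 -> k != 1 ->
       `|phase th k - phase_star t (phase th 0) (phase th 1) k| <= e)]].

End Minimizers.

(* Main.v *)
(* At the phases phi_k^* every mode of u(t, .) points in the direction phi_0 at
   x = x^*, so |u(t, x^* )| is almost sum_k c_k r_k, and the radii r_k^* minimise
   sum_k r_k^2 under the constraint sum_k c_k r_k = z_0 eps^(-1/2).  Since
   P(r_k >= r) = exp(-r^2), the radial constraints cost exp(-sum_k (r_k^* )^2),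
   which is exp(-z_0^2 / (eps sum_k c_k^2)) up to a factor negligible on the
   scale 1/eps.  For the matching lower bound, (phi_0, phi_1) is confined to a
   square of side eps^2 chosen so that none of the phi_k^* is close to the cut
   0 = 2 pi; U(eps) then contains a rectangle whose windows have polynomial size
   in eps, and there are only O(eps^(-1/2)) of them.
   On U(eps) the modes |k| <= eps^(-1/2) already give almost z_0 eps^(-1/2), so
   leaving D requires some r_k >= exp(b |k| / 2) / a with |k| > eps^(-1/2), an
   event of probability at most exp(- C exp(b eps^(-1/2) / 2)). *)
Require Import Defs.
From HB Require Import structures.
From mathcomp Require Import all_boot all_order all_algebra.
From mathcomp Require Import all_classical all_reals all_analysis.
From mathcomp Require Import measurable_realfun complex zify ring lra.

Set Implicit Arguments.
Unset Strict Implicit.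
Unset Printing Implicit Defensive.

Import Order.TTheory GRing.Theory Num.Theory.
Import numFieldNormedType.Exports.

Local Open Scope classical_set_scope.
Local Open Scope ring_scope.

(** * Symmetric partial sums over the integers *)

Section SymmetricSums.
Context {R : realType}.
Implicit Types (f g : int -> R) (n m : nat).

(** A duplicate-free sequence, because [param_law] gives the probabilities of rectangles over such
    sequences; its order is that of the partial sums in [zsum]. *)
Definition zball n : seq int := [seq i%:Z - n%:Z | i <- iota 0 n.*2.+1].
Arguments zball : simpl never.

Lemma zball_uniq n : uniq (zball n).
Proof. by rewrite map_inj_uniq ?iota_uniq// => i j /addIr []. Qed.

Lemma mem_zball n (k : int) : (k \in zball n) = (`|k| <= n)%N.
Proof.
apply/mapP/idP => [[i + ->]|kn]; first by rewrite mem_iota; lia.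
by exists (absz (k + n%:Z)); [rewrite mem_iota|]; lia.
Qed.

Definition zpart f n : R := \sum_(k <- zball n) f k.

Lemma zpart0 f : zpart f 0 = f 0.
Proof. by rewrite /zpart /zball /= big_seq1 subr0. Qed.

Lemma perm_zballS n :
  perm_eq (zball n.+1) [:: n.+1%:Z, - n.+1%:Z & zball n].
Proof.
apply: uniq_perm; first exact: zball_uniq.
  by rewrite cons_uniq in_cons mem_zball cons_uniq mem_zball zball_uniq; lia.
by move=> k; rewrite mem_zball 2!in_cons mem_zball; lia.
Qed.

Lemma zpartS f n : zpart f n.+1 = zpart f n + (f n.+1%:Z + f (- n.+1%:Z)).
Proof. by rewrite /zpart (perm_big _ (perm_zballS n)) 2!big_cons [RHS]addrC -addrA. Qed.

Lemma le_zpart f g n : (forall k : int, (`|k| <= n)%N -> f k <= g k) ->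
  zpart f n <= zpart g n.
Proof.
by move=> fg; rewrite /zpart !big_seq; apply: ler_sum => k; rewrite mem_zball => /fg.
Qed.

Lemma zpart_le f n m : (forall k, 0 <= f k) -> (n <= m)%N ->
  zpart f n <= zpart f m.
Proof.
move=> f0 /subnK <-; elim: (m - n)%N => [|j IH]; first by rewrite add0n.
by rewrite addSn zpartS (le_trans IH)// lerDl addr_ge0.
Qed.

Lemma zpart_diff_le f g n m : (n <= m)%N -> (forall k, f k <= g k) ->
  zpart f m - zpart f n <= zpart g m - zpart g n.
Proof.
move=> /subnK <- fg; elim: (m - n)%N => [|j IH]; first by rewrite add0n !subrr.
rewrite addSn !zpartS.
have := fg (j + n).+1; have := fg (- (j + n).+1%:Z); lra.
Qed.

Lemma zpartD f g n : zpart (fun k => f k + g k) n = zpart f n + zpart g n.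
Proof. by rewrite /zpart big_split. Qed.

Lemma zpartZ x f n : zpart (fun k => x * f k) n = x * zpart f n.
Proof. by rewrite /zpart mulr_sumr. Qed.

(** This is absolute summability; [summableP] identifies it with the condition in [sol_defined]. *)
Definition zbounded f := exists M, forall n, zpart (fun k => `|f k|) n <= M.

Lemma zpart_dist f n m : (n <= m)%N ->
  `|zpart f m - zpart f n| <=
  zpart (fun k => `|f k|) m - zpart (fun k => `|f k|) n.
Proof.
move=> /subnK <-; elim: (m - n)%N => [|j IH]; first by rewrite add0n !subrr normr0.
rewrite addSn !zpartS.
set x := f _; set y := f (- _).
have := ler_normD (zpart f (j + n) - zpart f n) (x + y).
rewrite addrAC; have := ler_normD x y; lra.
Qed.

Lemma zsumE f : zsum f = limn (zpart f).
Proof.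
by congr (lim (_ @ \oo)); apply/funext => n; rewrite /zpart big_map -/(index_iota 0 _)
  -(big_mkord xpredT (fun i : nat => f (i%:Z - n%:Z))).
Qed.

(** Both [|f|] and [f + |f|] are nonnegative and at most [2 * |f|], so their partial sums are
    monotone and bounded; [f] is their difference. *)
Lemma zpart_cvg f : zbounded f -> zpart f n @[n --> \oo] --> zsum f.
Proof.
move=> [M fM]; rewrite zsumE.
have cvg_mono g : (forall k, 0 <= g k) -> (forall k, g k <= 2 * `|f k|) ->
    cvgn (zpart g).
  move=> g0 gf; apply: nondecreasing_is_cvgn.
    by apply/nondecreasing_seqP => n; apply: zpart_le.
  exists (2 * M) => _ [n _ <-]; apply: (le_trans (@le_zpart g (fun k => 2 * `|f k|) n _)) => //.
  by rewrite zpartZ ler_pM2l.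
have ca : cvgn (zpart (fun k => `|f k|)).
  by apply: cvg_mono => k //; rewrite ler_peMl// ler1n.
have cb : cvgn (zpart (fun k => f k + `|f k|)).
  apply: cvg_mono => k; first by rewrite -lerBlDr sub0r lerNnormlW.
  by rewrite mulr_natl mulr2n lerD2r ler_norm.
have cab : cvgn (zpart f).
  have -> : zpart f = zpart (fun k => f k + `|f k|) - zpart (fun k => `|f k|).
    by apply/funext => n; rewrite !fctE zpartD addrK.
  exact: is_cvgB.
exact: cab.
Qed.

Lemma zbounded_le f g : (forall k, `|f k| <= `|g k|) -> zbounded g -> zbounded f.
Proof.
move=> fg [M gM]; exists M => n; apply: le_trans (gM n).
by apply: le_zpart => k _.
Qed.

Lemma zbounded_norm f : zbounded f -> zbounded (fun k => `|f k|).
Proof. by apply: zbounded_le => k; rewrite normr_id. Qed.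

Lemma zbounded_tail f n B :
  (forall m, (n <= m)%N ->
    zpart (fun k => `|f k|) m - zpart (fun k => `|f k|) n <= B) ->
  zbounded f.
Proof.
move=> fB; exists (B + zpart (fun k => `|f k|) n) => m.
have [nm|/ltnW mn] := leqP n m; first by rewrite -lerBlDr fB.
apply: le_trans (_ : _ <= zpart (fun k => `|f k|) n) _.
  exact: zpart_le.
by rewrite lerDr (le_trans _ (fB n _))// subrr.
Qed.

Lemma zsum_tail f n B :
  (forall m, (n <= m)%N ->
    zpart (fun k => `|f k|) m - zpart (fun k => `|f k|) n <= B) ->
  `|zsum f - zpart f n| <= B.
Proof.
move=> fB; have fc := zpart_cvg (zbounded_tail fB).
have /cvg_norm fd : zpart f m - zpart f n @[m --> \oo] --> zsum f - zpart f n.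
  by apply: cvgB => //; exact: cvg_cst.
rewrite -(cvg_lim _ fd)//; apply: limr_le; first by apply/cvg_ex; exists `|zsum f - zpart f n|.
exists n => //= m nm; exact: le_trans (zpart_dist f nm) (fB m nm).
Qed.

Lemma zpart_le_zsum f n : (forall k, 0 <= f k) -> zbounded f ->
  zpart f n <= zsum f.
Proof.
move=> f0 /zpart_cvg fc; rewrite -(cvg_lim _ fc)//.
apply: limr_ge; first by apply/cvg_ex; exists (zsum f).
by exists n => //= m nm; exact: zpart_le.
Qed.

Lemma zbounded_unif f e : zbounded f -> 0 < e -> exists n, forall m, (n <= m)%N ->
    zpart (fun k => `|f k|) m - zpart (fun k => `|f k|) n <= e.
Proof.
move=> /zbounded_norm /zpart_cvg /cvgrPdist_le + e0 => /(_ (e / 2)).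
rewrite divr_gt0// => /(_ isT) [n _ fn]; exists n => m nm.
have := fn n (leqnn n); have := fn m nm.
rewrite !ler_norml => /andP[? ?] /andP[? ?]; lra.
Qed.

Lemma geometric_tail f A q n m : 0 <= q < 1 ->
  (forall k : int, (n < `|k|)%N -> `|f k| <= A * q ^+ `|k|%N) -> (n <= m)%N ->
  zpart (fun k => `|f k|) m - zpart (fun k => `|f k|) n
    <= 2 * A * q ^+ n.+1 / (1 - q).
Proof.
move=> /andP[q0 q1] fA nm; have q1' : 0 < 1 - q by rewrite subr_gt0.
(* The sign comes from the assumed bound at [k = n + 1]. *)
have A0 : 0 <= A * q ^+ n.+1 by apply: le_trans (fA n.+1 _).
(* The induction runs on the exact finite geometric sum; the subtracted power is dropped only
   afterwards. *)
suff : zpart (fun k => `|f k|) m - zpart (fun k => `|f k|) n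
    <= 2 * A * (q ^+ n.+1 - q ^+ m.+1) / (1 - q).
  move=> /le_trans; apply; rewrite ler_pM2r ?invr_gt0//.
  rewrite mulrBr gerBl -mulrA mulr_ge0//.
  rewrite -(subnK nm) -addnS exprD mulrCA mulr_ge0// exprn_ge0//.
rewrite -(subnK nm); elim: (m - n)%N => [|j IH]; first by rewrite add0n !subrr mulr0 mul0r.
rewrite addSn zpartS.
have h1 : `|f (j + n).+1| <= A * q ^+ (j + n).+1 by apply: fA; lia.
have h2 : `|f (- (j + n).+1%:Z)| <= A * q ^+ (j + n).+1.
  by rewrite (le_trans (fA _ _))// abszN//; lia.
move: IH; rewrite !ler_pdivlMr// => IH.
have : (`|f (j + n).+1| + `|f (- (j + n).+1%:Z)|) * (1 - q) <=
  (2 * A * q ^+ (j + n).+1) * (1 - q) by rewrite ler_pM2r//; lra.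
move: IH; rewrite [q ^+ (j+n).+2]exprS.
nra.
Qed.

(** The unordered sum is a supremum over finite sets: every ball is one of them, and every finite
    set lies in the ball whose radius is its largest modulus. *)
Lemma summableP f : summable [set: int] (fun k => (f k)%:E) <-> zbounded f.
Proof.
split=> [|[M fM]].
  rewrite summableE => /fineK sE.
  exists (fine (\esum_(x in [set: int]) `|(f x)%:E|)%E) => n.
  rewrite -lee_fin sE; apply: esum_ge; exists [set` zball n].
    by split; [exact: finite_seq|].
  by rewrite /zpart -sumEFin (fsbig_seq _ _ (zball_uniq n)).
apply: (@le_lt_trans _ _ M%:E); last exact: ltry.
apply: ge_ereal_sup => _ [X [/finite_seqP[s ->] _] <-].
pose n := (\max_(k <- s) `|k|)%N.
apply: (@le_trans _ _ (zpart (fun k => `|f k|) n)%:E); last by rewrite lee_fin.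
rewrite /zpart -sumEFin (fsbig_seq _ _ (zball_uniq n)).
apply: lee_fsum_nneg_subset; [exact: finite_seq|exact: finite_seq|move=> k|by []].
by rewrite !mem_setE mem_zball => ks; apply: (@leq_bigmax_seq _ s xpredT absz).
Qed.

Lemma zsum_comb f g x y : zbounded f -> zbounded g ->
  zsum (fun k => x * f k + y * g k) = x * zsum f + y * zsum g.
Proof.
move=> bf bg; rewrite zsumE; apply/cvg_lim => //.
have -> : zpart (fun k => x * f k + y * g k) =
    fun n => x * zpart f n + y * zpart g n.
  by apply/funext => n; rewrite zpartD !zpartZ.
by apply: cvgD; (apply: cvgM; [exact: cvg_cst|exact: zpart_cvg]).
Qed.
End SymmetricSums.

(** * Rayleigh and uniform probabilities of intervals *)

Section Laws.
Context {R : realType}.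
Implicit Types (x y : R).

(** Primitive of the Rayleigh density on the half-line, chosen to vanish at infinity. *)
Let F x : R := - expR (- x ^+ 2).

Let dF x : is_derive x 1 F (2 * x * expR (- x ^+ 2)).
Proof.
rewrite (_ : F = - (expR \o (- (id ^+ 2)))); last exact/funext.
apply: trigger_derive.
by rewrite /GRing.scale/= expr1 mulr1 !fctE; ring.
Qed.

Let cF : continuous F.
Proof. by move=> x; apply: cvgN; exact: continuous_gauss_fun. Qed.

Let cf : continuous (fun x => 2 * x * expR (- x ^+ 2)).
Proof.
move=> x; apply: cvgM; last exact: continuous_gauss_fun.
by apply: cvgM; [exact: cvg_cst|exact: cvg_id].
Qed.

Let pdfE x (B : set R) : 0 <= x -> B `<=` [set r | x <= r] ->
  (rayleigh_law B = \int[lebesgue_measure]_(r in B) (2 * r * expR (- r ^+ 2))%:E)%E.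
Proof.
move=> x0 Bx; apply: eq_integral => r; rewrite inE => /Bx /= xr.
by rewrite /rayleigh_pdf (le_trans x0 xr).
Qed.

Lemma rayleigh_law_tail x : 0 <= x ->
  rayleigh_law `[x, +oo[%classic = (expR (- x ^+ 2))%:E.
Proof.
move=> x0; rewrite (pdfE x0); last by move=> r; rewrite /= in_itv/= andbT.
rewrite (@ge0_continuous_FTC2y _ _ F _ 0).
- by rewrite add0e -EFinN opprK.
- by move=> r xr; rewrite mulr_ge0 ?expR_ge0// mulr_ge0// (le_trans x0).
- exact: continuous_subspaceT.
- rewrite -oppr0; apply: cvgN; exact: cvg_gauss_fun.
- by move=> r _; exact: ex_derive.
- exact/cvg_at_right_filter/cF.
- by move=> r _; rewrite derive1E; exact: derive_val.
Qed.

Lemma rayleigh_law_itv x y : 0 <= x -> x < y ->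
  rayleigh_law `[x, y]%classic = (expR (- x ^+ 2) - expR (- y ^+ 2))%:E.
Proof.
move=> x0 xy; rewrite (pdfE x0); last by move=> r; rewrite /= in_itv/= => /andP[].
rewrite (@continuous_FTC2 _ _ F)//.
- by rewrite -EFinB opprK addrC.
- exact: continuous_subspaceT.
- split; last 2 first.
  + exact/cvg_at_right_filter/cF.
  + exact/cvg_at_left_filter/cF.
  by move=> r _; exact: ex_derive.
- by move=> r _; rewrite derive1E; exact: derive_val.
Qed.

Lemma phase_lawT : phase_law [set: R] = 1%E.
Proof. exact: probability_setT. Qed.

Let phase_lawE (B : set R) : measurable B -> B `<=` `[0, 2 * pi] ->
  phase_law B = ((2 * pi)^-1%:E * lebesgue_measure B)%E.
Proof.
move=> mB Bs; rewrite /phase_law /uniform_prob integral_uniform_pdf setIidl//.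
rewrite (eq_integral (fun=> ((2 * pi)^-1)%:E)) ?integral_cst//.
by move=> r; rewrite inE => /Bs /=; rewrite in_itv/= /uniform_pdf subr0 => ->.
Qed.

Lemma phase_law_itv x y : 0 <= x -> x < y -> y <= 2 * pi ->
  phase_law `[x, y]%classic = ((y - x) / (2 * pi))%:E.
Proof.
move=> x0 xy y2; rewrite phase_lawE//.
  by rewrite lebesgue_measure_itv/= lte_fin xy -EFinB -EFinM mulrC.
by move=> r /=; rewrite !in_itv/= => /andP[? ?]; apply/andP; split; lra.
Qed.

(** The phase law lives on the closed interval while [paramH] asks for the half-open one; the
    endpoint is a null set. *)
Lemma phase_law_fundamental : phase_law `[0%R, (2 * pi : R)[%classic = 1%E.
Proof.
have p0 : (0 : R) < 2 * pi by exact: lt0_2pi.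
rewrite phase_lawE//; last by apply: subset_itvl; rewrite bnd_simp.
by rewrite lebesgue_measure_itv/= lte_fin p0 -EFinB subr0 -EFinM mulVf// gt_eqF.
Qed.

End Laws.

(** * Measurability *)

Section Measurability.
Context {R : realType}.
Notation T := (param_space R).
Implicit Types (c f : int -> R) (th : T).

Lemma measurable_coord (k : int) : measurable_fun [set: T] (fun th : T => (th k : R * R)).
Proof.
move=> _ B mB; rewrite setTI; apply: sub_sigma_algebra.
by exists k, B.
Qed.

Lemma measurable_ampl (k : int) : measurable_fun [set: T] (fun th => ampl th k).
Proof. exact: measurableT_comp (@measurable_fst _ _ _ _) (measurable_coord k). Qed.

Lemma measurable_phase (k : int) : measurable_fun [set: T] (fun th => phase th k).
Proof. exact: measurableT_comp (@measurable_snd _ _ _ _) (measurable_coord k). Qed.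

(** Enumeration by [unpickle] makes the quantifier a countable intersection; numbers that code no
    index contribute the whole space. *)
Lemma measurable_forall (I : countType) (Q : I -> T -> Prop) :
  (forall i, measurable [set th | Q i th]) -> measurable [set th | forall i, Q i th].
Proof.
move=> mQ.
rewrite (_ : [set _ | _] =
  \bigcap_n (if unpickle n is Some i then [set th | Q i th] else setT)).
  by apply: bigcapT_measurable => n; case: unpickle.
apply/seteqP; split=> th /= Qth.
  by move=> n _; case: unpickle => [i|//]; exact: Qth.
by move=> i; have := Qth (pickle i) Logic.I; rewrite pickleK.
Qed.

Lemma measurable_exists (I : countType) (Q : I -> T -> Prop) :
  (forall i, measurable [set th | Q i th]) -> measurable [set th | exists i, Q i th].
Proof.
move=> mQ; rewrite (_ : [set _ | _] = ~` [set th | forall i, ~ Q i th]).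
  by apply: measurableC; apply: measurable_forall => i; apply: measurableC; exact: mQ.
apply/seteqP; split=> th /=; first by move=> [i Qi] /(_ i).
by move=> /existsNP[i /contrapT Qi]; exists i.
Qed.

Lemma measurable_impl (Q : Prop) (A : set T) :
  (Q -> measurable A) -> measurable [set th | Q -> A th].
Proof.
move=> mA; have [q|nq] := pselect Q.
  by rewrite (_ : [set _ | _] = A); [exact: mA|apply/seteqP; split=> th /= //; exact].
by rewrite (_ : [set _ | _] = setT)//; apply/seteqP; split=> // th _ /nq.
Qed.

Lemma measurable_le_set (f g : T -> R) : measurable_fun setT f -> measurable_fun setT g ->
  measurable [set th | f th <= g th].
Proof. by move=> mf mg; rewrite -[X in measurable X]setTI; exact: measurable_fun_le. Qed.

Lemma measurable_lt_set (f g : T -> R) : measurable_fun setT f -> measurable_fun setT g ->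
  measurable [set th | f th < g th].
Proof.
move=> mf mg; rewrite (_ : [set _ | _] = ~` [set th | g th <= f th]).
  by apply: measurableC; exact: measurable_le_set.
by apply/seteqP; split=> th /=; rewrite ltNge => /negP.
Qed.

Lemma measurable_paramH : measurable (@paramH R).
Proof.
rewrite (_ : @paramH R = [set th | forall k, ([set th | 0 <= ampl th k] `&`
    ([set th | 0 <= phase th k] `&` [set th | phase th k < 2 * pi])) th]).
  apply: measurable_forall => k; apply: measurableI; last apply: measurableI.
  - by apply: measurable_le_set => //; exact: measurable_ampl.
  - by apply: measurable_le_set => //; exact: measurable_phase.
  - by apply: measurable_lt_set => //; exact: measurable_phase.
apply/seteqP; split=> th /= Hth k.
  by have [? /andP] := Hth k.
by have [? [? ?]] := Hth k; split=> //; apply/andP.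
Qed.

Lemma measurable_mod2pi (f : T -> R) : measurable_fun setT f ->
  measurable_fun setT (fun th => mod2pi (f th)).
Proof.
move=> mf; apply: measurable_funB => //; apply: measurable_funM => //.
apply: (@measurableT_comp _ _ _ _ _ _ (fun y : R => (Num.floor y)%:~R : R)).
  apply: nondecreasing_measurable => // x y xy.
  by rewrite ler_int le_floor.
by apply: measurable_funM.
Qed.

Lemma measurable_calU c b z0 t e : measurable (calU c b z0 t e).
Proof.
rewrite (_ : calU _ _ _ _ _ = @paramH R `&`
  [set th | forall k : int, `|k|%:~R <= - (1 / b) * ln (2 * zsum (fun j => c j ^+ 2) / z0
                                   * e `^ (9 / 10)) ->
     ([set th | ampl_star c z0 e k <= ampl th k] `&`
      [set th | ampl th k <= ampl_star c z0 e k + e `^ (2 / 5)]) th] `&`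
  [set th | forall k : int, `|k|%:~R <= e `^ (- (1 / 2)) -> k != 0 -> k != 1 ->
     `|phase th k - phase_star t (phase th 0) (phase th 1) k| <= e]).
  apply: measurableI; first apply: measurableI; first exact: measurable_paramH.
    apply: measurable_forall => k; apply: measurable_impl => _.
    by apply: measurableI; apply: measurable_le_set => //; exact: measurable_ampl.
  apply: measurable_forall => k; do 3 apply: measurable_impl => _.
  apply: measurable_le_set => //; apply: measurableT_comp => //.
  apply: measurable_funB; first exact: measurable_phase.
  apply: measurable_mod2pi; apply: measurable_funD => //; apply: measurable_funB => //.
    exact: measurable_phase.
  apply: measurable_funM => //; apply: measurable_mod2pi; apply: measurable_funD => //.
  by apply: measurable_funB; exact: measurable_phase.
apply/seteqP; split=> th /=.
  by move=> [Hth Ath Pth]; split; [split=> // k /Ath /andP[]|].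
by move=> [[Hth Ath] Pth]; split=> // k /Ath /andP.
Qed.

End Measurability.

(** * Continuity in x of the modulus of the solution, and measurability of the exceedance event *)

Section Solution.
Context {R : realType}.
Notation T := (param_space R).
Implicit Types (c f : int -> R) (th : T) (t x z : R).

Definition solRe c t x th : R :=
  zsum (fun k => c k * ampl th k * cos (k%:~R * x + phase th k - k%:~R ^+ 2 * t)).
Definition solIm c t x th : R :=
  zsum (fun k => c k * ampl th k * sin (k%:~R * x + phase th k - k%:~R ^+ 2 * t)).

Lemma norm_solE c t x th :
  complex.Re `|sol c t x th| = Num.sqrt (solRe c t x th ^+ 2 + solIm c t x th ^+ 2).
Proof.
rewrite /sol /zsumC /=; congr (Num.sqrt (_ ^+ 2 + _ ^+ 2)); congr zsum;
  apply/funext => k /=; by rewrite mul0r ?subr0 ?addr0.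
Qed.

Lemma calDP c t z th : calD c t z th <->
  [/\ paramH th, zbounded (fun k => c k * ampl th k) &
    exists2 x, x \in `[0, 2 * pi] &
      z < Num.sqrt (solRe c t x th ^+ 2 + solIm c t x th ^+ 2)].
Proof.
split=> [[Hth /summableP sth]|[Hth /summableP sth [x x02 zx]]].
  by move=> /ereal_sup_gt[_ [x x02 <-]]; rewrite norm_solE lte_fin; split=> //; exists x.
split=> //; apply/ereal_sup_gtP.
exists (Num.sqrt (solRe c t x th ^+ 2 + solIm c t x th ^+ 2))%:E; last by rewrite lte_fin.
by exists x => //; rewrite norm_solE.
Qed.

(** Weierstrass M-test: the majorant [g] provides one truncation order valid for all [x], and the
    truncated sum is continuous. *)
Lemma zsum_continuous (g : int -> R) (h : R -> int -> R) : zbounded g ->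
  (forall x k, `|h x k| <= `|g k|) -> (forall k, continuous (h ^~ k)) ->
  continuous (fun x => zsum (h x)).
Proof.
move=> bg hg ch x; apply/cvgrPdist_le => e e0.
have e3 : 0 < e / 3 by rewrite divr_gt0.
have [n gn] := zbounded_unif bg e3.
have hn y : `|zsum (h y) - zpart (h y) n| <= e / 3.
  apply: zsum_tail => m nm; apply: le_trans (gn m nm).
  exact: zpart_diff_le.
have cn : {for x, continuous (fun y => zpart (h y) n)}.
  by apply: cvg_big => [|k _]; [exact: add_continuous|exact: ch].
near=> y.
have : `|zpart (h x) n - zpart (h y) n| <= e / 3.
  by near: y; move/cvgrPdist_le : cn; exact.
have := hn x; have := hn y; rewrite !ler_norml => /andP[? ?] /andP[? ?] /andP[? ?].
by apply/andP; split; lra.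
Unshelve. all: by end_near. Qed.

(** The bound can be taken to be a natural number, which leaves a countable union. *)
Lemma measurable_zbounded (f : int -> T -> R) :
  (forall k, measurable_fun setT (f k)) -> measurable [set th | zbounded (f ^~ th)].
Proof.
move=> mf.
rewrite (_ : [set _ | _] =
  [set th | exists M : nat, forall n, zpart (fun k => `|f k th|) n <= M%:R]).
  apply: measurable_exists => M; apply: measurable_forall => n.
  apply: measurable_le_set => //; apply: measurable_sum => k.
  exact: measurableT_comp.
apply/seteqP; split=> th /= [M fM].
  by exists (Num.truncn M).+1 => n; rewrite (le_trans (fM n))// ltW// truncnS_gt.
by exists M%:R.
Qed.

Lemma measurable_zsum (D : set T) (f : int -> T -> R) : measurable D ->
  (forall k, measurable_fun setT (f k)) ->
  (forall th, D th -> zbounded (f ^~ th)) ->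
  measurable_fun D (fun th => zsum (f ^~ th)).
Proof.
move=> mD mf bf.
apply: (measurable_fun_cvg (h := fun n th => zpart (f ^~ th) n)) => [n|th Dth].
  apply: measurable_sum => k; exact: measurable_funTS.
exact/zpart_cvg/bf.
Qed.

(** Retraction of the line onto [[0, 2 * pi]]. After composition with it every rational is an
    admissible sample point, and density of the rationals in the whole line suffices. *)
Let clamp (x : R) : R := Num.max 0 (Num.min x (2 * pi)).

Let clamp_continuous : continuous clamp.
Proof.
apply: (@max_fun_continuous _ R R (cst 0) (id \min cst (2 * pi))).
  by move=> x; exact: cvg_cst.
by apply: min_fun_continuous => x; [exact: cvg_id|exact: cvg_cst].
Qed.

Let clamp_itv x : clamp x \in `[0, 2 * pi].
Proof.
have p0 := @lt0_2pi R; rewrite in_itv/= /clamp le_max lexx/=.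
by rewrite ge_max ltW// ge_min lexx orbT.
Qed.

Let clampE x : x \in `[0, 2 * pi] -> clamp x = x.
Proof.
rewrite in_itv/= /clamp => /andP[x0 x2].
by rewrite (min_idPl x2) (max_idPr x0).
Qed.

Let modulus c t x th : R := Num.sqrt (solRe c t x th ^+ 2 + solIm c t x th ^+ 2).

Let normrM_le1 (y u : R) : `|u| <= 1 -> `|y * u| <= `|y|.
Proof. by move=> u1; rewrite normrM ler_piMr. Qed.

Let modulus_continuous c t th : zbounded (fun k => c k * ampl th k) ->
  continuous (fun x => modulus c t x th).
Proof.
move=> bth.
have cc : continuous (fun x => solRe c t x th).
  apply: (zsum_continuous bth) => [x k|k x].
    exact/normrM_le1/cos_max.
  apply: cvgM; first exact: cvg_cst.
  apply: continuous_comp; last exact: continuous_cos.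
  apply: cvgB; last exact: cvg_cst.
  by apply: cvgD; [apply: cvgM; [exact: cvg_cst|exact: cvg_id]|exact: cvg_cst].
have cs : continuous (fun x => solIm c t x th).
  apply: (zsum_continuous bth) => [x k|k x].
    exact/normrM_le1/sin_max.
  apply: cvgM; first exact: cvg_cst.
  apply: continuous_comp; last exact: continuous_sin.
  apply: cvgB; last exact: cvg_cst.
  by apply: cvgD; [apply: cvgM; [exact: cvg_cst|exact: cvg_id]|exact: cvg_cst].
move=> x; apply: continuous_comp; last exact: sqrt_continuous.
by apply: cvgD; apply: continuous_comp (@exprn_continuous _ 2 _); [exact: cc|exact: cs].
Qed.

(** By continuity in [x], the modulus exceeds [z] somewhere on the interval exactly when it does so
    at some clamped rational, so the event is a countable union. *)
Lemma measurable_calD c t z : measurable (calD c t z).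
Proof.
pose E : set T := [set th | zbounded (fun k => c k * ampl th k)].
have mE : measurable E.
  apply: (measurable_zbounded (f := fun k th => c k * ampl th k)) => k.
  by apply: measurable_funM => //; exact: measurable_ampl.
have mtrig x (u : R -> R) : continuous u -> forall k : int, measurable_fun setT
    (fun th : T => c k * ampl th k * u (k%:~R * x + phase th k - k%:~R ^+ 2 * t)).
  move=> cu k; apply: measurable_funM.
    by apply: measurable_funM => //; exact: measurable_ampl.
  apply: measurableT_comp; first exact: continuous_measurable_fun.
  apply: measurable_funB => //; apply: measurable_funD => //; exact: measurable_phase.
have mmod x : measurable_fun E (fun th => modulus c t x th).
  apply: (measurableT_comp (continuous_measurable_fun (@sqrt_continuous R))).
  apply: measurable_funD; apply: measurable_funX.
    apply: (measurable_zsum mE (mtrig x _ (@continuous_cos R))) => th; apply: zbounded_le.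
    by move=> k; exact/normrM_le1/cos_max.
  apply: (measurable_zsum mE (mtrig x _ (@continuous_sin R))) => th; apply: zbounded_le.
  by move=> k; exact/normrM_le1/sin_max.
rewrite (_ : calD c t z = @paramH R `&`
    [set th | exists q : rat, (E `&` [set th | z < modulus c t (clamp (ratr q)) th]) th]).
  apply: measurableI; first exact: measurable_paramH.
  apply: measurable_exists => q.
  (* The modulus is known to be measurable only on [E], hence the strict inequality is written as a
     difference inside [E]. *)
  rewrite (_ : _ `&` _ = E `\` (E `&` [set th | modulus c t (clamp (ratr q)) th <= z])).
    apply: measurableD => //; apply: measurable_fun_le => //.
  apply/seteqP; split=> th /= [Eth].
    by move=> zth; split=> // -[_]; rewrite leNgt zth.
  by move=> nz; split=> //; rewrite ltNge; apply/negP => h; exact: nz.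
apply/seteqP; split=> th.
  move=> /calDP[Hth bth [x x02 zx]]; split=> //.
  pose O := [set y | z < modulus c t (clamp y) th].
  have oO : open O.
    apply: (@open_comp _ _ (fun y => modulus c t (clamp y) th) [set y | z < y]);
      last exact: open_gt.
    move=> y _; apply: (@continuous_comp _ _ _ clamp (fun x => modulus c t x th)).
      exact: clamp_continuous.
    exact: modulus_continuous.
  have O0 : O !=set0 by exists x; rewrite /O/= clampE.
  by have [y [Oy [q _ qy]]] := dense_rat O0 oO; exists q; rewrite qy.
move=> [Hth [q [bth zq]]]; apply/calDP; split=> //.
by exists (clamp (ratr q)).
Qed.

End Solution.

(** * Probabilities of rectangles and of the parameter space *)

Section Probability.
Context {R : realType} {P : probability (param_space R) R} (hP : param_law P).
Notation T := (param_space R).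

Let prodEFin (s : seq int) (f : int -> R) :
  (\prod_(k <- s) (f k)%:E)%E = (\prod_(k <- s) f k)%:E.
Proof. by elim: s => [|k s IH]; rewrite ?big_nil// !big_cons IH EFinM. Qed.

Lemma measurable_rect (s : seq int) (A B : int -> set R) :
  (forall k, measurable (A k)) -> (forall k, measurable (B k)) ->
  measurable [set th : T | forall k, k \in s -> A k (ampl th k) /\ B k (phase th k)].
Proof.
move=> mA mB; apply: measurable_forall => k.
apply: (measurable_impl (A := [set th | A k (ampl th k) /\ B k (phase th k)])) => _.
apply: measurableI; rewrite -[X in measurable X]setTI.
  by apply: measurable_ampl.
by apply: measurable_phase.
Qed.

Lemma prob_rect (s : seq int) (A B : int -> set R) (al be : int -> R) : uniq s ->
  (forall k, measurable (A k)) -> (forall k, measurable (B k)) ->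
  (forall k, k \in s -> rayleigh_law (A k) = (al k)%:E) ->
  (forall k, k \in s -> phase_law (B k) = (be k)%:E) ->
  P [set th | forall k, k \in s -> A k (ampl th k) /\ B k (phase th k)]
  = (\prod_(k <- s) (al k * be k))%:E.
Proof.
move=> us mA mB Aal Bbe; rewrite hP// -prodEFin; apply: eq_big_seq => k ks.
by rewrite Aal// Bbe.
Qed.

Lemma prob_ampl_tail (k : int) (x : R) : 0 <= x ->
  P [set th | x <= ampl th k] = (expR (- x ^+ 2))%:E.
Proof.
move=> x0.
have := @prob_rect [:: k] (fun=> `[x, +oo[%classic) (fun=> setT)
  (fun=> expR (- x ^+ 2)) (fun=> 1) isT.
rewrite big_seq1 mulr1 => <- //.
- congr (P _); apply/seteqP; split=> th /=.
    by move=> xth j; rewrite inE => /eqP ->; rewrite in_itv/= xth.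
  by move=> /(_ k (mem_head _ _))[]; rewrite in_itv/= andbT.
- by move=> ? _; exact: rayleigh_law_tail.
- by move=> ? _; exact: phase_lawT.
Qed.

Lemma le_prob (A B : set T) : measurable A -> measurable B -> A `<=` B -> (P A <= P B)%E.
Proof. by move=> mA mB AB; apply: le_measure; rewrite ?inE. Qed.

(** Each single coordinate satisfies its constraint with probability one, and the complement is a
    countable union of the exceptional null sets. *)
Lemma prob_paramH : P (@paramH R) = 1%E.
Proof.
suff h : P (~` @paramH R) = 0%E.
  have := @probability_setC _ _ _ P _ (measurableC (@measurable_paramH R)).
  by rewrite setCK h sube0.
pose G (k : int) := [set th : T | 0 <= ampl th k /\ 0 <= phase th k < 2 * pi].
have GE k : G k = [set th | forall j, j \in [:: k] ->
    `[0, +oo[%classic (ampl th j) /\ `[0, 2 * pi[%classic (phase th j)].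
  apply/seteqP; split=> th /=.
    by move=> Gth j; rewrite inE => /eqP ->; rewrite !in_itv/= andbT.
  by move=> /(_ k (mem_head _ _)); rewrite !in_itv/= andbT.
have mG k : measurable (G k) by rewrite GE; exact: (@measurable_rect [:: k] (fun=> _) (fun=> _)).
have PG k : P (G k) = 1%E.
  rewrite GE (@prob_rect [:: k] (fun=> _) (fun=> _) (fun=> 1) (fun=> 1))//.
  - by rewrite big_seq1 mulr1.
  - by move=> ? _; rewrite rayleigh_law_tail// expr0n/= oppr0 expR0.
  - by move=> ? _; rewrite phase_law_fundamental.
apply/eqP; rewrite eq_le measure_ge0 andbT.
pose F n : set T := if unpickle n is Some k then ~` (G k) else set0.
have mF n : measurable (F n).
  by rewrite /F; case: unpickle => [k|//]; apply: measurableC.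
apply: (@le_trans _ _ (\sum_(n <oo) P (F n))%E).
  apply: measure_sigma_subadditive => //; first by apply: measurableC; exact: measurable_paramH.
  move=> th /= /existsNP[k Gth]; exists (pickle k) => //.
  by rewrite /F pickleK.
rewrite eseries0// => n _ _; rewrite /F; case: unpickle => [k|]; last exact: measure0.
by rewrite probability_setC// PG subee.
Qed.

Lemma prob_setI_paramH (A : set T) : measurable A -> P (A `&` @paramH R) = P A.
Proof.
move=> mA; have mH := @measurable_paramH R.
have h : P (~` @paramH R) = 0%E by rewrite probability_setC// prob_paramH subee.
apply/eqP; rewrite eq_le le_prob//; last exact: measurableI.
rewrite -{1}(setIT A) -(setUv (@paramH R)) setIUr.
apply: le_trans (measureU2 _ _ _) _.
- exact: measurableI.
- by apply: measurableI => //; apply: measurableC.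
rewrite -[leRHS]adde0 leeD2l// -h le_prob//.
- by apply: measurableI => //; apply: measurableC.
- by apply: measurableC.
Qed.

Lemma prob_bigcup_geometric (A : set T) (F : nat -> set T) (D rho : R) :
  0 <= rho < 1 -> measurable A -> (forall n, measurable (F n)) ->
  A `<=` \bigcup_n F n -> (forall n, (P (F n) <= (D * rho ^+ n)%:E)%E) ->
  (P A <= (D / (1 - rho))%:E)%E.
Proof.
move=> /andP[r0 r1] mA mF AF PF; have r1' : 0 < 1 - rho by rewrite subr_gt0.
have D0 : 0 <= D by rewrite -lee_fin -[D]mulr1 -(expr0 rho); apply: le_trans (PF 0%N).
have geo n : \sum_(0 <= i < n) (D * rho ^+ i) <= D * (1 - rho ^+ n) / (1 - rho).
  elim: n => [|n IH]; first by rewrite big_geq// expr0 subrr mulr0 mul0r.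
  rewrite big_nat_recr//= (le_trans (lerD IH (lexx _)))// exprS.
  by rewrite le_eqVlt; apply/orP; left; apply/eqP; field; rewrite gt_eqF.
apply: (@le_trans _ _ (\sum_(n <oo) P (F n))%E).
  exact: measure_sigma_subadditive.
apply: lime_le; first exact: is_cvg_nneseries.
near=> n; apply: (@le_trans _ _ (\sum_(0 <= i < n) (D * rho ^+ i))%:E).
  by rewrite -sumEFin; apply: lee_sum => i _.
rewrite lee_fin; apply: (@le_trans _ _ (D * (1 - rho ^+ n) / (1 - rho))).
  exact: geo.
by rewrite ler_pM2r ?invr_gt0// ler_piMr// lerBlDr lerDl exprn_ge0.
Unshelve. all: by end_near. Qed.

(** The event lies in a rectangle whose phases are free, and by independence its probability is the
    product of the Rayleigh tails. *)
Lemma prob_ampl_ge (A : set T) (x : int -> R) (n : nat) : measurable A ->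
  (forall k, 0 <= x k) ->
  (forall th k, A th -> (`|k| <= n)%N -> x k <= ampl th k) ->
  (P A <= (expR (- zpart (fun k => (x k) ^+ 2) n))%:E)%E.
Proof.
move=> mA x0 Ax.
rewrite /zpart -sumrN expR_sum (eq_bigr (fun k => expR (- x k ^+ 2) * 1)); last first.
  by move=> k _; rewrite mulr1.
have := @prob_rect (zball n) (fun k => `[x k, +oo[%classic) (fun=> setT)
  (fun k => expR (- x k ^+ 2)) (fun=> 1) (zball_uniq n).
move=> <- //.
- apply: le_prob => //.
    exact: (@measurable_rect _ (fun k => `[x k, +oo[%classic) (fun=> setT)).
  by move=> th Ath k; rewrite mem_zball => /(Ax _ _ Ath) /=; rewrite in_itv/= andbT.
- by move=> k _; exact: rayleigh_law_tail.
- by move=> k _; exact: phase_lawT.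
Qed.

End Probability.

(** * Modulus near a minimizer *)

Section Containment.
Context {R : realType}.
Implicit Types (x y : R).

Lemma normr_sin_le x : `|sin x| <= `|x|.
Proof.
wlog x0 : x / 0 <= x.
  move=> h; have [|/ltW x0] := leP 0 x; first exact: h.
  by rewrite -(normrN (sin x)) -sinN -(normrN x) h// oppr_ge0.
have [|y _] := @MVT_segment R sin cos 0 x x0 (fun y _ => is_derive_sin y).
  exact/continuous_subspaceT/continuous_sin.
rewrite sin0 !subr0 => ->; rewrite normrM ler_piMl//; exact: cos_max.
Qed.

(** For [x = 2 * y], the cosine is [1 - 2 * sin y ^+ 2], and [|sin y| <= |y|]. *)
Lemma cos_ge_quadratic x : 1 - x ^+ 2 / 2 <= cos x.
Proof.
have : x = (x / 2) *+ 2 by rewrite mulr2n -splitr.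
move: (x / 2) => y ->; rewrite cos_mulr2n; have := normr_sin_le y.
rewrite -ler_sqr ?nnegrE// !real_normK ?num_real//.
have := cos2Dsin2 y; have -> : (y *+ 2) ^+ 2 / 2 = 2 * y ^+ 2 by rewrite -mulr_natl; field.
by rewrite -mulr_natl; move: (cos y ^+ 2) (sin y ^+ 2) (y ^+ 2) => u v w; lra.
Qed.

Lemma cosD2pi_int x (j : int) : cos (x + 2 * pi * j%:~R) = cos x.
Proof.
have cosn y (n : nat) : cos (y + 2 * pi * n%:R) = cos y.
  by rewrite mulr_natr (mulr_natl pi 2) (periodicn (@cosD2pi R)).
case: (intP j) => [|n|n]; first by rewrite mulr0 addr0.
  by rewrite cosn.
by rewrite mulrNz mulrN -[RHS](cosn _ n.+1) -[in RHS](subrK (2 * pi * n.+1%:R) x) cosn cosn.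
Qed.

Lemma mod2pi_shift x : exists j : int, mod2pi x = x + 2 * pi * j%:~R.
Proof. by exists (- Num.floor (x / (2 * pi))); rewrite mulrNz mulrN. Qed.

Lemma mod2pi_itv x : 0 <= mod2pi x < 2 * pi.
Proof.
have p0 := @lt0_2pi R; rewrite /mod2pi.
have /andP[] := floor_itv (x / (2 * pi)).
rewrite ler_pdivlMr// ltr_pdivrMr// intrD mulrDl mul1r.
by move: (_%:~R) => fl h1 h2; apply/andP; split; lra.
Qed.

(* At x^* every mode of moderate frequency has its phase within e of phi_0, so
   the modulus is bounded below by the real part of exp(-i phi_0) u. *)
Lemma calD_of_near_minimizer (c rs : int -> R) (t e d z : R) (n N : nat)
    (th : param_space R) :
  (forall k, 0 <= c k) -> 0 <= e <= 1 -> (n <= N)%N -> paramH th ->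
  (forall k : int, 0 <= rs k) ->
  (forall k : int, (`|k| <= n)%N -> rs k <= ampl th k) ->
  (forall k : int, (`|k| <= N)%N -> k != 0 -> k != 1 ->
     `|phase th k - phase_star t (phase th 0) (phase th 1) k| <= e) ->
  (forall m, (N <= m)%N -> zpart (fun k => `|c k * ampl th k|) m
     - zpart (fun k => `|c k * ampl th k|) N <= d) ->
  z < (1 - e ^+ 2 / 2) * zpart (fun k => c k * rs k) n - d ->
  calD c t z th.
Proof.
move=> c0 /andP[e0 e1] nN Hth rs0 rth pth tail zlt; apply/calDP.
have r0 k : 0 <= ampl th k by have [] := Hth k.
have bth := zbounded_tail tail.
split=> //; pose xs := x_star t (phase th 0) (phase th 1).
have /andP[xs0 xs2] : 0 <= xs < 2 * pi by exact: mod2pi_itv.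
exists xs; first by rewrite in_itv/= xs0 ltW.
pose X := solRe c t xs th; pose Y := solIm c t xs th; pose p0 := phase th 0.
pose y k := k%:~R * xs + phase th k - k%:~R ^+ 2 * t.
pose g k := c k * ampl th k * cos (y k - p0).
have gE : zsum g = cos p0 * X + sin p0 * Y.
  rewrite -zsum_comb; first by congr zsum; apply/funext => k; rewrite /g cosB /y; ring.
    by apply: zbounded_le bth => k; rewrite normrM ler_piMr//; exact: cos_max.
  by apply: zbounded_le bth => k; rewrite normrM ler_piMr//; exact: sin_max.
have gX : zsum g <= Num.sqrt (X ^+ 2 + Y ^+ 2).
  rewrite gE (le_trans (ler_norm _))// -sqrtr_sqr ler_wsqrtr//.
  have := cos2Dsin2 p0; have := sqr_ge0 (cos p0 * Y - sin p0 * X).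
  (* Lagrange's identity: the projection of [(X, Y)] on a unit vector is at most its norm. *)
  move: (cos p0) (sin p0) => u v h1 h2.
  have : (u * X + v * Y) ^+ 2 + (u * Y - v * X) ^+ 2 =
    (X ^+ 2 + Y ^+ 2) * (u ^+ 2 + v ^+ 2) by ring.
  by rewrite h2 mulr1 => <-; rewrite lerDl.
have cosy k : (`|k| <= N)%N -> 1 - e ^+ 2 / 2 <= cos (y k - p0).
  move=> kN; have [j jE] : exists j : int, xs = p0 - phase th 1 + t + 2 * pi * j%:~R.
    exact: mod2pi_shift.
  have e2 : 0 <= e ^+ 2 by exact: sqr_ge0.
  (* Mode 0 is aligned exactly and mode 1 up to whole turns, by the choice of [xs]; the other modes
     are aligned up to [e]. *)
  have [->|k0] := eqVneq k 0.
    rewrite /y !mulr0z mul0r add0r expr0n/= mul0r subr0 subrr cos0; lra.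
  have [->|k1] := eqVneq k 1.
    have -> : y 1 - p0 = 0 + 2 * pi * j%:~R by rewrite /y jE mulr1z; ring.
    rewrite cosD2pi_int cos0; lra.
  have [i iE] : exists i : int, phase_star t p0 (phase th 1) k =
      p0 - k%:~R * xs + k%:~R ^+ 2 * t + 2 * pi * i%:~R by exact: mod2pi_shift.
  have -> : y k - p0 = phase th k - phase_star t p0 (phase th 1) k + 2 * pi * i%:~R.
    by rewrite iE /y; ring.
  rewrite cosD2pi_int; apply: le_trans (cos_ge_quadratic _).
  have := pth k kN k0 k1; rewrite -/p0.
  rewrite -(ler_sqr (x := `|_|)) ?nnegrE// real_normK ?num_real//; lra.
have kap : 0 <= 1 - e ^+ 2 / 2.
  have : e ^+ 2 <= 1 by exact: exprn_ile1.
  lra.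
(* Radii are bounded below by [rs] only up to [n]; the modes between [n] and [N] have nonnegative
   terms and are dropped. *)
have gN : (1 - e ^+ 2 / 2) * zpart (fun k => c k * rs k) n <= zpart g N.
  apply: (@le_trans _ _ ((1 - e ^+ 2 / 2) * zpart (fun k => c k * ampl th k) N)).
    rewrite ler_wpM2l//; apply: (@le_trans _ _ (zpart (fun k => c k * ampl th k) n)).
      by apply: le_zpart => k kn; rewrite ler_wpM2l// rth.
    by apply: zpart_le => // k; rewrite mulr_ge0.
  rewrite -zpartZ; apply: le_zpart => k kN.
  by rewrite mulrC ler_wpM2l ?mulr_ge0// cosy.
have gd : `|zsum g - zpart g N| <= d.
  apply: zsum_tail => m Nm; apply: le_trans (tail m Nm).
  apply: zpart_diff_le => // k; rewrite normrM ler_piMr//; exact: cos_max.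
apply: lt_le_trans gX; move: gd; rewrite ler_norml => /andP[]; lra.
Qed.

End Containment.

(** * Lower bound for the probability *)

Section LowerBound.
Context {R : realType}.
Implicit Types (x y v : R).

(** Two representatives in the fundamental interval differ by less than one turn, hence by zero
    turns. *)
Lemma mod2pi_unique v (j : int) : 0 <= v < 2 * pi -> mod2pi (v + 2 * pi * j%:~R) = v.
Proof.
move=> /andP[v0 v2]; have p0 := @lt0_2pi R.
have [i iE] := mod2pi_shift (v + 2 * pi * j%:~R).
have /andP[] := mod2pi_itv (v + 2 * pi * j%:~R).
rewrite iE -addrA -mulrDr -intrD => h0 h2.
suff -> : j + i = 0 by rewrite mulr0 addr0.
have : `|(j + i)%:~R : R| < 1.
  rewrite -(ltr_pM2l p0) mulr1 -[X in X * `|_|](ger0_norm (ltW p0)) -normrM ltr_norml.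
  by apply/andP; split; lra.
by rewrite -intr_norm -[X in _ < X]/(1%:~R) ltr_int; lia.
Qed.

(* Among M equally spaced rotations each of the fewer than M points is close to
   the cut of the circle for at most one rotation. *)
Lemma rotation_off_cut (s : seq int) (w : int -> R) (M : nat) : (size s < M)%N ->
  exists2 al : R, 0 <= al <= 2 * pi - 2 * pi / M%:R &
    forall k, k \in s -> pi / M%:R <= mod2pi (al + w k) <= 2 * pi - pi / M%:R.
Proof.
move=> sM; have p0 := @lt0_2pi R.
have M0 : 0 < M%:R :> R by rewrite ltr0n (leq_ltn_trans _ sM).
pose al (j : 'I_M) : R := 2 * pi * j%:R / M%:R.
have alP j : 0 <= al j <= 2 * pi - 2 * pi / M%:R.
  rewrite /al divr_ge0 ?mulr_ge0 ?pi_ge0 ?ler0n//=.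
  have -> : 2 * pi - 2 * pi / M%:R = 2 * pi * (M%:R - 1) / M%:R :> R.
    by field; rewrite gt_eqF.
  rewrite ler_pM2r ?invr_gt0// ler_pM2l// lerBrDr natr1 ler_nat; exact: ltn_ord.
have [[j jP]|nj] := pselect (exists j : 'I_M, forall k, k \in s ->
    pi / M%:R <= mod2pi (al j + w k) <= 2 * pi - pi / M%:R).
  by exists (al j).
move/forallNP : nj => nj.
(* If no rotation works, each one has a mode within [pi / M] of the cut; choosing such a mode yields
   a map from [M] rotations to [s]. *)
have near_cut (j : 'I_M) : exists k, k \in s /\
    exists i : int, `|al j + w k + 2 * pi * i%:~R| < pi / M%:R.
  have /existsNP[k /not_implyP[ks /negP]] := nj j.
  rewrite negb_and -!ltNge => hk; exists k; split=> //.
  have [i iE] := mod2pi_shift (al j + w k).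
  have /andP[] := mod2pi_itv (al j + w k); rewrite iE in hk * => h0 h2.
  have d0 : 0 < pi / M%:R :> R by rewrite divr_gt0// pi_gt0.
  case/orP: hk => hk; first by exists i; rewrite ger0_norm.
  exists (i - 1); rewrite intrB ltr_norml; apply/andP; split; lra.
have [f fP] := choice near_cut.
have finj : injective f.
  move=> j j' jj'; apply/val_inj => /=.
  have [_ [i hi]] := fP j; have [_ [i' hi']] := fP j'; rewrite -jj' in hi'.
  (* Two rotations that send the same mode near the cut differ by less than [2 * pi / M] up to whole
     turns. The rescaled difference is an integer, hence zero, and [j], [j'] are both below [M]. *)
  have : `|(j%:Z - j'%:Z + M%:Z * (i - i'))%:~R : R| < 1.
    rewrite -(ltr_pM2l p0) mulr1 -(ltr_pM2r (x := M%:R^-1)) ?invr_gt0//.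
    have -> : 2 * pi * `|(j%:Z - j'%:Z + M%:Z * (i - i'))%:~R| / M%:R =
        `|(al j + w (f j) + 2 * pi * i%:~R) - (al j' + w (f j) + 2 * pi * i'%:~R)| :> R.
      rewrite -[X in X * `|_|](ger0_norm (ltW p0)) -normrM.
      rewrite -[X in _ * X](ger0_norm (x := M%:R^-1)) ?invr_ge0 ?ler0n// -normrM.
      congr `|_|; rewrite intrD intrM !intrB /al !pmulrn; field.
      by rewrite gt_eqF.
    apply: le_lt_trans (ler_normB _ _) _.
    have -> : 2 * pi / M%:R = pi / M%:R + pi / M%:R :> R by rewrite -mulrDl mulr_natl mulr2n.
    exact: ltrD.
  rewrite -intr_norm -[X in _ < X]/(1%:~R) ltr_int => h.
  have := ltn_ord j; have := ltn_ord j'; move: h; move: (i - i') => n h lj' lj.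
  have [n0|[n1|n1]] : n = 0 \/ 1 <= n \/ n <= -1 by lia.
  - by rewrite n0 in h; lia.
  - have : M%:Z <= M%:Z * n by rewrite ler_peMr.
    lia.
  - have : M%:Z * n <= - M%:Z by rewrite -mulrN1 ler_wpM2l.
    lia.
have : (size [seq f j | j <- enum 'I_M] <= size s)%N.
  apply: uniq_leq_size; first by rewrite map_inj_uniq ?enum_uniq.
  by move=> _ /mapP[j _ ->]; have [] := fP j.
by rewrite size_map size_enum_ord leqNgt sM.
Qed.

(** The exponent grows by at least [d ^+ 2 >= e] across the window, and
    [1 - expR (- e) >= e / (1 + e) >= e / 2]. *)
Lemma rayleigh_window_ge (r d e : R) : 0 <= r -> 0 < d -> 0 <= e <= 1 -> e <= d ^+ 2 ->
  expR (- r ^+ 2) * (e / 2) <= expR (- r ^+ 2) - expR (- (r + d) ^+ 2).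
Proof.
move=> r0 d0 /andP[e0 e1] ed.
have -> : - (r + d) ^+ 2 = - r ^+ 2 + - ((r + d) ^+ 2 - r ^+ 2) by ring.
rewrite expRD -{2}[expR (- r ^+ 2)]mulr1 -mulrBr ler_wpM2l ?expR_ge0//.
apply: (@le_trans _ _ (1 - expR (- e))).
  have e1' : 0 < 1 + e by rewrite ltr_pwDl.
  apply: (@le_trans _ _ (1 - (1 + e)^-1)); last first.
    by rewrite lerB// expRN lef_pV2 ?posrE ?expR_gt0// expR_ge1Dx.
  have -> : 1 - (1 + e)^-1 = e / (1 + e) by field; rewrite gt_eqF.
  by rewrite ler_wpM2l// lef_pV2 ?posrE//; lra.
rewrite lerB// ler_expR lerN2 (le_trans ed)//.
by have : 0 <= r * d by [rewrite mulr_ge0// ltW]; nra.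
Qed.

End LowerBound.

(** * Stability of the aligned phases under small changes of the first two phases *)

Section PhaseWindow.
Context {R : realType}.
Implicit Types (e t al : R).

Lemma absz_le_of_real (k : int) (N : nat) (x : R) :
  `|k|%:~R <= x -> x < N.+1%:R -> (`|k| <= N)%N.
Proof.
by move=> kx xN; have := le_lt_trans kx xN; rewrite -abszE -pmulrn ltr_nat.
Qed.

(** At [p0 = p1 = al] the aligned phase is [al + (k ^+ 2 - k) * t] modulo [2 * pi]. Moving [p0] and
    [p1] shifts it by [o], of size at most [(2 * N + 1) * e ^+ 2], and the distance to the cut
    prevents a jump of the representative. *)
Lemma phase_star_near t al e p0 p1 (k : int) (N : nat) :
  (`|k| <= N)%N -> 0 <= e -> (2 * N + 1)%:R * e <= 1 / 2 ->
  al <= p0 <= al + e ^+ 2 -> al <= p1 <= al + e ^+ 2 ->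
  e < 2 * mod2pi (al + (k%:~R ^+ 2 - k%:~R) * t) < 4 * pi - e ->
  `|phase_star t p0 p1 k - mod2pi (al + (k%:~R ^+ 2 - k%:~R) * t)| <= e / 2.
Proof.
move=> kN e0 Ne /andP[p00 p01] /andP[p10 p11].
have [i iE] := mod2pi_shift (al + (k%:~R ^+ 2 - k%:~R) * t).
set v := mod2pi _ in iE * => /andP[v0 v2].
have [j jE] : exists j : int, x_star t p0 p1 = p0 - p1 + t + 2 * pi * j%:~R.
  exact: mod2pi_shift.
pose o := (1 - k%:~R) * (p0 - al) + k%:~R * (p1 - al).
have oe : `|o| <= e / 2.
  have kN' : `|k%:~R : R| <= N%:R by rewrite -intr_norm -abszE -pmulrn ler_nat.
  apply: (@le_trans _ _ ((2 * N + 1)%:R * e ^+ 2)); last first.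
    by rewrite expr2 mulrA; move: Ne; move: (_%:R) => M Ne; nra.
  rewrite natrD natrM mulrDl; apply: le_trans (ler_normD _ _) _.
  rewrite !normrM.
  have h0 : `|p0 - al| <= e ^+ 2 by rewrite ler_norml; apply/andP; split; lra.
  have h1 : `|p1 - al| <= e ^+ 2 by rewrite ler_norml; apply/andP; split; lra.
  have h2 : `|1 - k%:~R : R| <= 1 + N%:R.
    by rewrite (le_trans (ler_normB _ _))// normr1 lerD2l.
  apply: (@le_trans _ _ ((1 + N%:R) * e ^+ 2 + N%:R * e ^+ 2)); last lra.
  by apply: lerD; apply: ler_pM.
rewrite /phase_star jE.
(* The turns [j] hidden in [x_star] get multiplied by the integer [k] and remain whole turns. *)
have -> : p0 - k%:~R * (p0 - p1 + t + 2 * pi * j%:~R) + k%:~R ^+ 2 * t =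
    (v + o) + 2 * pi * (- i - k * j)%:~R.
  by rewrite intrB intrM !mulrNz iE /o; ring.
move: oe; rewrite ler_norml => /andP[lo hi].
rewrite mod2pi_unique; last by apply/andP; split; lra.
by rewrite addrC addrA addNr add0r ler_norml lo.
Qed.

End PhaseWindow.

(** * A rectangle inside U(eps) and its probability *)

Section Bounds.
Context {R : realType} {P : probability (param_space R) R} (hP : param_law P).
Context (c : int -> R) (b z0 t e : R).
Hypotheses (c0 : forall k, 0 <= c k) (S0 : 0 < zsum (fun k => c k ^+ 2)).
Hypotheses (z0_gt0 : 0 < z0) (e01 : 0 < e <= 1).

Lemma ampl_star_ge0 k : 0 <= ampl_star c z0 e k.
Proof.
rewrite /ampl_star divr_ge0 ?(ltW S0)// !mulr_ge0 ?powR_ge0 ?(ltW z0_gt0)//.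
Qed.

(** Beyond its Gaussian cost, each of the [2 * N + 1] modes pays at least [e / 2] for the radial
    window and [e ^+ 2 / (2 * pi)] for the phase window; the product of the two is
    [e ^+ 3 / (4 * pi)]. *)
Lemma prob_calU_ge (N : nat) :
  (2 * N + 1)%:R * e <= 1 / 2 -> e `^ (- (1 / 2)) < N.+1%:R ->
  - (1 / b) * ln (2 * zsum (fun j => c j ^+ 2) / z0 * e `^ (9 / 10))
    <= e `^ (- (1 / 2)) ->
  e <= (e `^ (2 / 5)) ^+ 2 ->
  ((expR (- zpart (fun k => ampl_star c z0 e k ^+ 2) N)
    * (e ^+ 3 / (4 * pi)) ^+ (2 * N + 1))%:E <= P (calU c b z0 t e))%E.
Proof.
move=> Ne Nw Kw ed; have /andP[e_gt0 e_le1] := e01.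
have pi2 : 2 <= pi :> R by exact: pi_ge2.
(* One rotation more than there are modes, as the pigeonhole argument requires. *)
pose M := (2 * N + 2)%N.
have size_zball : size (zball N) = (2 * N + 1)%N.
  by rewrite size_map size_iota -mul2n addn1.
have [|al /andP[al0 al2] alP] := @rotation_off_cut R (zball N)
  (fun k => (k%:~R ^+ 2 - k%:~R) * t) M; first by rewrite size_zball /M addn1 addn2.
have M0 : 0 < M%:R :> R by rewrite ltr0n /M addn2.
have Me : e * M%:R <= 3 / 2.
  have -> : M = (2 * N + 1 + 1)%N by rewrite /M -addnA.
  by rewrite natrD mulrDr mulr1 mulrC; lra.
(* The distance to the cut left by the rotation exceeds [e], so every phase window fits inside the
   fundamental interval. *)
have eM : e < pi / M%:R by rewrite ltr_pdivlMr//; lra.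
have e2e : e ^+ 2 <= e by rewrite expr2 ler_piMl// ltW.
pose v k := mod2pi (al + (k%:~R ^+ 2 - k%:~R) * t).
pose A k := `[ampl_star c z0 e k, ampl_star c z0 e k + e `^ (2 / 5)]%classic.
(* The windows of half-width [e / 2] around [v k] use half of the allowed deviation [e]; the
   displacement of the aligned phase, at most [e / 2], uses the other half. *)
pose B (k : int) := if (k == 0) || (k == 1) then `[al, al + e ^+ 2]%classic
  else `[v k - e / 2, v k + e / 2]%classic.
pose ra k := expR (- ampl_star c z0 e k ^+ 2) -
  expR (- (ampl_star c z0 e k + e `^ (2 / 5)) ^+ 2).
pose be (k : int) := (if (k == 0) || (k == 1) then e ^+ 2 else e) / (2 * pi).
have mA k : measurable (A k) by exact: measurable_itv.
have mB k : measurable (B k) by rewrite /B; case: ifP => _; exact: measurable_itv.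
have d0 : 0 < e `^ (2 / 5) by exact: powR_gt0.
have piM : 2 * pi / M%:R = 2 * (pi / M%:R) :> R by rewrite mulrA.
have := prob_setI_paramH hP (@measurable_rect _ (zball N) A B mA mB).
rewrite (@prob_rect _ _ hP (zball N) A B ra be (zball_uniq N))//; last 2 first.
- by move=> k _; rewrite rayleigh_law_itv ?ampl_star_ge0// ltrDl.
- move=> k /alP /andP[v1 v2]; rewrite /B /be; case: ifP => _.
    rewrite phase_law_itv//; first by rewrite addrAC subrr add0r.
      by rewrite ltrDl exprn_gt0.
    by move: al2; rewrite piM; lra.
  rewrite phase_law_itv//; rewrite -/(v k) in v1 v2; [|lra|lra|lra].
  by congr ((_ / _)%:E); lra.
move=> rectE; apply: (@le_trans _ _ (\prod_(k <- zball N) (ra k * be k))%:E).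
  rewrite lee_fin /zpart -sumrN expR_sum -size_zball.
  have : e ^+ 3 / (4 * pi) = e / 2 * (e ^+ 2 / (2 * pi)).
    by move: (pi : R) (pi_gt0 R) => p p_gt0; field; rewrite gt_eqF.
  have : 0 <= e ^+ 3 / (4 * pi).
    by rewrite divr_ge0 ?exprn_ge0 ?mulr_ge0 ?pi_ge0// ltW.
  move: (e ^+ 3 / (4 * pi)) => K K0 KE.
  have -> : K ^+ size (zball N) = \prod_(k <- zball N) K.
    by rewrite big_const_seq count_predT iter_mulr_1.
  rewrite -big_split/=; apply: ler_prod => k _; rewrite mulr_ge0 ?expR_ge0//=.
  rewrite KE [leLHS]mulrA; apply: ler_pM.
  - by rewrite mulr_ge0 ?expR_ge0// divr_ge0// ltW.
  - by rewrite divr_ge0 ?exprn_ge0 ?mulr_ge0 ?pi_ge0// ltW.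
  - by apply: rayleigh_window_ge => //; [exact: ampl_star_ge0|rewrite ltW].
  - rewrite /be ler_pM2r ?invr_gt0 ?mulr_gt0 ?pi_gt0//; case: ifP => // _.
rewrite -rectE; apply: le_prob => //.
- by apply: measurableI; [exact: measurable_rect|exact: measurable_paramH].
- exact: measurable_calU.
move=> th [rth Hth]; split=> //.
  move=> k kK; have /rth[] : k \in zball N.
    by rewrite mem_zball; apply: absz_le_of_real Nw; exact: le_trans kK Kw.
  by rewrite /A /= in_itv.
move=> k kw k0 k1.
have kN : (`|k| <= N)%N by apply: absz_le_of_real Nw.
have ph01 j : (j == 0) || (j == 1) -> (j \in zball N) -> al <= phase th j <= al + e ^+ 2.
  by move=> j01 /rth[_]; rewrite /B j01 /= in_itv.
have [_] := rth k (etrans (mem_zball _ _) kN).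
rewrite /B (negbTE k0) (negbTE k1)/= in_itv/= => /andP[phk1 phk2].
have /andP[vk1 vk2] := alP k (etrans (mem_zball _ _) kN).
(* Mode 1 must belong to the ball for its phase to be confined near [al]. *)
have N1 : (1 <= N)%N.
  rewrite -ltnS -(ltr_nat R); apply: le_lt_trans Nw.
  have : e `^ (1 / 2) <= 1 `^ (1 / 2) by rewrite ge0_ler_powR ?nnegrE// ltW.
  by rewrite powR1 powRN invf_ge1 ?powR_gt0.
have := @phase_star_near R t al e (phase th 0) (phase th 1) k N kN (ltW e_gt0) Ne.
rewrite -/(v k) !ph01 ?mem_zball// => /(_ isT isT).
have /[swap]/[apply] : e < 2 * v k < 4 * pi - e.
  by apply/andP; split; rewrite -/(v k) in vk1 vk2; lra.
rewrite !ler_norml => /andP[h1 h2]; apply/andP; split; lra.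
Qed.

End Bounds.

(** * Asymptotics *)

Section Tenth.
Context {R : realType}.
Implicit Types (e C : R).

(* The exponents 9/10, 2/5 and -1/2 are all multiples of 1/10. *)
Definition tenth e : R := e `^ (1 / 10).

Lemma tenth_gt0 e : 0 < e -> 0 < tenth e.
Proof. exact: powR_gt0. Qed.

Lemma powR_tenth e (r : R) (n : nat) : r = n%:R / 10 -> e `^ r = tenth e ^+ n.
Proof.
by move=> ->; rewrite -powR_mulrn ?powR_ge0// -powRrM div1r mulrC.
Qed.

Lemma tenthX10 e : 0 < e -> tenth e ^+ 10 = e.
Proof. by move=> e0; rewrite -(@powR_tenth e 1) ?powRr1 ?ltW// divff. Qed.

Lemma powR_Nhalf e : e `^ (- (1 / 2)) = (tenth e ^+ 5)^-1.
Proof. by rewrite powRN (@powR_tenth e _ 5)//; field. Qed.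

(** The smallness requirements on [e] in the asymptotic estimates are brought to this single
    form. *)
Lemma near_tenth_small C : \forall e \near (0 : R)^'+, C * tenth e <= 1.
Proof.
have C0 : 0 < (`|C| + 1)^-1 by rewrite invr_gt0 ltr_wpDl.
near=> e.
have e0 : 0 < e by near: e; exact: nbhs_right_gt.
have eC : e < (`|C| + 1)^-1 ^+ 10 by near: e; apply: nbhs_right_lt; rewrite exprn_gt0.
have wC : tenth e < (`|C| + 1)^-1.
  by rewrite -(@ltr_pXn2r _ 10) ?nnegrE ?(ltW C0) ?ltW ?tenth_gt0// tenthX10.
apply: (@le_trans _ _ ((`|C| + 1) * tenth e)).
  by rewrite ler_wpM2r ?(ltW (tenth_gt0 _))// (le_trans (ler_norm C))// lerDl.
by rewrite mulrC -ler_pdivlMr ?ltr_wpDl// div1r ltW.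
Unshelve. all: by end_near. Qed.

Lemma cvg_of_le_tenth (f : R -> R) (l C : R) :
  (\forall e \near (0 : R)^'+, `|f e - l| <= C * tenth e) ->
  f e @[e --> (0 : R)^'+] --> l.
Proof.
move=> fC; apply/cvgrPdist_le => d d0; near=> e.
rewrite distrC; apply: (@le_trans _ _ (C * tenth e)); first by near: e.
have : C / d * tenth e <= 1 by near: e; exact: near_tenth_small.
by rewrite mulrAC ler_pdivrMr// mul1r.
Unshelve. all: by end_near. Qed.

Lemma near_right0P (Q : R -> Prop) : (\forall e \near (0 : R)^'+, Q e) ->
  exists2 e0 : R, 0 < e0 & forall e, 0 < e < e0 -> Q e.
Proof.
move=> /nbhs_ballP[e0 /= e0_gt0 eQ]; exists e0 => // e /andP[e_gt0 ee0].
by apply: eQ => //=; rewrite /ball/= sub0r normrN gtr0_norm.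
Qed.

Lemma Nln_le (w : R) : 0 < w -> - ln w <= w^-1.
Proof. by move=> w0; rewrite -lnV ?posrE// ltW// ln_sublinear// invr_gt0. Qed.

End Tenth.

(** * The large deviations limit and the exceptional set, for geometrically dominated
    coefficients *)

Section Asymptotics.
Context {R : realType} (a b z0 t : R) (c : int -> R).
Hypotheses (a_gt0 : 0 < a) (b_gt0 : 0 < b) (z0_gt0 : 0 < z0).
Hypotheses (c_gt0 : forall k, 0 < c k).
Hypotheses (c_le : forall k, c k <= a * expR (- b) ^+ absz k).

Let q := expR (- b).
Let S := zsum (fun k => c k ^+ 2).

Lemma expRN_01 (x : R) : 0 < x -> 0 <= expR (- x) < 1.
Proof. by move=> x0; rewrite expR_ge0 expR_lt1 oppr_lt0. Qed.

Let q01 : 0 <= q ^+ 2 < 1.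
Proof.
have /andP[q0 q1] := expRN_01 b_gt0.
by rewrite exprn_ge0// exprn_ilt1.
Qed.

Let sqr_le (k : int) : `|c k ^+ 2| <= a ^+ 2 * (q ^+ 2) ^+ absz k.
Proof.
rewrite ger0_norm ?sqr_ge0// -exprM mulnC exprM -exprMn.
by rewrite ler_sqr ?nnegrE// ?(ltW (c_gt0 k))// mulr_ge0 ?(ltW a_gt0)// exprn_ge0// expR_ge0.
Qed.

Let T := 2 * a ^+ 2 / (1 - q ^+ 2).

Let T_ge0 : 0 <= T.
Proof.
have /andP[_ q1] := q01.
by apply: divr_ge0; [rewrite mulr_ge0 ?sqr_ge0|rewrite subr_ge0 ltW].
Qed.

Let zbounded_sqr : zbounded (fun k => c k ^+ 2).
Proof.
by apply: (@zbounded_tail _ _ 0%N) => m; apply: (geometric_tail q01).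
Qed.

Let zpart_sqr_le n : zpart (fun k => c k ^+ 2) n <= S.
Proof. by apply: zpart_le_zsum => // k; exact: sqr_ge0. Qed.

Let S_gt0 : 0 < S.
Proof. by apply: lt_le_trans (zpart_sqr_le 0); rewrite zpart0 exprn_gt0. Qed.

Let sqr_tail n : S - zpart (fun k => c k ^+ 2) n <= T * (q ^+ n.+1) ^+ 2.
Proof.
apply: le_trans (ler_norm _) _; apply: zsum_tail => m nm.
have := geometric_tail q01 (fun k _ => sqr_le k) nm.
by rewrite /T -!exprM mulnC [X in _ <= X]mulrAC.
Qed.

(** The frequency [K] solving [expR (- b * K) = 2 * S / z0 * e ^ (9 / 10)], up to which [calU]
    constrains the radii. *)
Let cutoff (e : R) := - (1 / b) * ln (2 * S / z0 * e `^ (9 / 10)).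
Let D := 2 * S / z0.

Let D_gt0 : 0 < D.
Proof. by rewrite divr_gt0// mulr_gt0. Qed.

Let cutoffE e : cutoff e = - ln (D * tenth e ^+ 9) / b.
Proof. by rewrite /cutoff (@powR_tenth _ e _ 9)// div1r mulNr mulrC mulNr. Qed.

Let cutoff_ge0 e : 0 < e -> D * tenth e ^+ 9 <= 1 -> 0 <= cutoff e.
Proof.
by move=> e0 De; rewrite cutoffE divr_ge0 ?(ltW b_gt0)// oppr_ge0 ln_le0.
Qed.

(** The first omitted frequency, truncation plus one, exceeds the cutoff, so the corresponding power
    of [q] is at most [D * tenth e ^+ 9]. *)
Let cutoff_tail e : 0 < e ->
  S - zpart (fun k => c k ^+ 2) (Num.truncn (cutoff e)) <= T * (D * tenth e ^+ 9) ^+ 2.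
Proof.
move=> e0; apply: le_trans (sqr_tail _) _; rewrite ler_wpM2l//.
have y0 : 0 < D * tenth e ^+ 9 by rewrite mulr_gt0// exprn_gt0// tenth_gt0.
rewrite ler_sqr ?nnegrE ?exprn_ge0 ?expR_ge0 ?(ltW y0)//.
rewrite -expRM_natr -[leRHS]lnK// ler_expR mulNr lerNl.
rewrite -ler_pdivrMl// -mulrC -cutoffE ltW//; exact: truncnS_gt.
Qed.

(** The cutoff is logarithmic in [e]. With [v] the inverse of [tenth e], it is at most
    [(|ln D| + 9) / b * v], hence at most [v ^+ 2], below [v ^+ 5]. *)
Let cutoff_le e : 0 < e -> tenth e <= 1 -> (`|ln D| + 9) / b * tenth e <= 1 ->
  cutoff e <= e `^ (- (1 / 2)).
Proof.
move=> e0 w1 Ce; have w0 := tenth_gt0 e0.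
rewrite cutoffE powR_Nhalf lnM ?posrE ?exprn_gt0// lnXn//.
have := Nln_le w0; rewrite -exprVn.
have Mv : (`|ln D| + 9) / b <= (tenth e)^-1 by rewrite -[leRHS]div1r ler_pdivlMr.
have : 1 <= (tenth e)^-1 by rewrite invf_ge1.
move: (tenth e)^-1 Mv => v Mv v1 lnv.
apply: (@le_trans _ _ (v ^+ 2)); last by rewrite ler_weXn2l.
apply: (@le_trans _ _ ((`|ln D| + 9) / b * v)); last by rewrite expr2 ler_wpM2r// (le_trans _ v1).
rewrite mulrAC ler_pM2r ?invr_gt0//.
have -> : ln (tenth e) *+ 9 = 9 * ln (tenth e) by rewrite mulr_natl.
have : `|ln D| <= `|ln D| * v by rewrite ler_peMr.
by have := ler_norm (- ln D); rewrite normrN; lra.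
Qed.

Let ampl_starX2 e k : 0 < e ->
  ampl_star c z0 e k ^+ 2 = (z0 / S) ^+ 2 / e * c k ^+ 2.
Proof.
move=> e0; rewrite /ampl_star powR_Nhalf -{2}(tenthX10 e0) -/S.
have := S_gt0; have := tenth_gt0 e0; move: (tenth e) S => w s w0 s0.
by field; rewrite !gt_eqF.
Qed.

Context {P : probability (param_space R) R} (hP : param_law P).

Let cutoff_mem e (k : int) (th : param_space R) : 0 <= cutoff e ->
  calU c b z0 t e th -> (`|k| <= Num.truncn (cutoff e))%N ->
  ampl_star c z0 e k <= ampl th k.
Proof.
move=> K0 [_ rth _]; rewrite truncn_ge_nat// => kK.
by have /andP[] : ampl_star c z0 e k <= ampl th k <= ampl_star c z0 e k + e `^ (2 / 5)
  by apply: rth; rewrite -abszE -pmulrn.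
Qed.

Let zpart_ampl_starX2 e n : 0 < e ->
  zpart (fun k => ampl_star c z0 e k ^+ 2) n =
  (z0 / S) ^+ 2 / e * zpart (fun k => c k ^+ 2) n.
Proof.
by move=> e0; rewrite -zpartZ; congr zpart; apply/funext => k; exact: ampl_starX2.
Qed.

Let prob_calU_le e : 0 < e <= 1 -> D * tenth e ^+ 9 <= 1 ->
  (P (calU c b z0 t e) <=
   (expR (- ((z0 / S) ^+ 2 / e * zpart (fun k => c k ^+ 2) (Num.truncn (cutoff e)))))%:E)%E.
Proof.
move=> /andP[e0 e1] De; rewrite -zpart_ampl_starX2//.
apply: (prob_ampl_ge hP) => [|k|th k Uth kn].
- exact: measurable_calU.
- by apply: ampl_star_ge0 => // j; exact: ltW.
- exact: cutoff_mem (cutoff_ge0 e0 De) Uth kn.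
Qed.

(** Logarithmic loss per mode in [prob_calU_ge]: it equals [ln (4 * pi) - 30 * ln (tenth e)], and
    both terms are absorbed by the inverse of [tenth e]. *)
Let ln_kappa_ge (e : R) : 0 < e -> tenth e <= 1 ->
  - ln (e ^+ 3 / (4 * pi)) <= (4 * pi + 30) / tenth e.
Proof.
move=> e0 w1; have w0 := tenth_gt0 e0.
have pi4 : 0 < 4 * pi :> R by rewrite mulr_gt0// pi_gt0.
rewrite lnM ?posrE ?invr_gt0 ?exprn_gt0// lnV ?posrE// opprB.
rewrite -{1}(tenthX10 e0) -exprM lnXn// [leRHS]mulrDl; apply: lerD.
  rewrite (le_trans (ltW (ln_sublinear pi4)))// ler_pdivlMr//.
  by rewrite ler_piMr// ltW.
have -> : - (ln (tenth e) *+ (10 * 3)) = 30 * - ln (tenth e).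
  by rewrite mulr_natl mulNrn.
by rewrite ler_wpM2l// Nln_le.
Qed.

Lemma ldp_calU : (e%:E * lne (P (calU c b z0 t e)))%E @[e --> (0 : R)^'+]
     --> (- (z0 ^+ 2 / S))%:E.
Proof.
pose p e := fine (P (calU c b z0 t e)).
have PE e : P (calU c b z0 t e) = (p e)%:E.
  by rewrite /p fineK// fin_num_measure//; exact: measurable_calU.
(* The first summand covers the number of modes times the loss per mode in the lower bound; the
   second covers the squares beyond the cutoff, where [(z0 / S) ^+ 2 * T * D ^+ 2 = 4 * T]. *)
pose C := 3 * (4 * pi + 30) + 4 * T.
have bounds : \forall e \near (0 : R)^'+,
    0 < p e /\ `|e * ln (p e) - (- (z0 ^+ 2 / S))| <= C * tenth e.
  near=> e.
  have e0 : 0 < e by near: e; exact: nbhs_right_gt.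
  have w0 := tenth_gt0 e0.
  have w6 : 6 * tenth e <= 1 by near: e; exact: near_tenth_small.
  have w1 : tenth e <= 1 by lra.
  have Dw : D * tenth e <= 1 by near: e; exact: near_tenth_small.
  have cw : (`|ln D| + 9) / b * tenth e <= 1 by near: e; exact: near_tenth_small.
  have wXle i j : (i <= j)%N -> tenth e ^+ j <= tenth e ^+ i.
    by move=> ij; apply: ler_wiXn2l => //; rewrite ltW.
  have D9 : D * tenth e ^+ 9 <= 1.
    by apply: le_trans Dw; rewrite ler_pM2l// (wXle 1%N).
  have e01 : 0 < e <= 1 by rewrite e0 -(tenthX10 e0) (wXle 0%N).
  pose N := Num.truncn ((tenth e ^+ 5)^-1).
  have N5 : N%:R <= (tenth e ^+ 5)^-1.
    by rewrite truncn_le invr_ge0 exprn_ge0// ltW.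
  have Ne : (2 * N + 1)%:R * e <= 3 * tenth e ^+ 5.
    rewrite -{1}(tenthX10 e0) (exprD _ 5 5) mulrA ler_pM2r ?exprn_gt0//.
    rewrite -ler_pdivlMr ?exprn_gt0// natrD natrM.
    have : 1 <= (tenth e ^+ 5)^-1 by rewrite invf_ge1 ?exprn_gt0// (wXle 0%N).
    lra.
  have c0 k : 0 <= c k by exact: ltW.
  have := @prob_calU_ge _ _ hP c b z0 t e c0 S_gt0 z0_gt0 e01 N.
  have -> : (2 * N + 1)%:R * e <= 1 / 2.
    by apply: le_trans Ne _; have := wXle 1%N 5%N isT; rewrite expr1; lra.
  rewrite powR_Nhalf truncnS_gt -powR_Nhalf => /(_ isT isT (cutoff_le e0 w1 cw)).
  rewrite (@powR_tenth _ e (2 / 5) 4) -?exprM//; last by field.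
  (* The square of the radial window width is [e ^ (4 / 5)], which dominates [e]. *)
  have -> : e <= tenth e ^+ (4 * 2) by rewrite -{1}(tenthX10 e0) wXle.
  move=> /(_ isT); rewrite PE lee_fin zpart_ampl_starX2//.
  have := prob_calU_le e01 D9; rewrite PE lee_fin => upper lower.
  have k0 : 0 < e ^+ 3 / (4 * pi) by rewrite divr_gt0 ?exprn_gt0 ?mulr_gt0 ?pi_gt0.
  have p0 : 0 < p e.
    by apply: lt_le_trans lower; rewrite mulr_gt0 ?expR_gt0 ?exprn_gt0.
  split=> //; move: upper lower.
  rewrite -[X in X <= _ -> _]lnK ?posrE// ler_expR => upper.
  rewrite -ler_ln ?posrE ?mulr_gt0 ?expR_gt0 ?exprn_gt0//.
  rewrite lnM ?posrE ?expR_gt0 ?exprn_gt0// expRK lnXn// => lower.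
  have zS : z0 ^+ 2 / S = (z0 / S) ^+ 2 * S.
    by have := S_gt0; move: S => s s0; field; rewrite gt_eqF.
  have G0 : 0 <= (z0 / S) ^+ 2 by exact: sqr_ge0.
  rewrite opprK ler_norml zS; apply/andP; split.
    have : e * (- ((z0 / S) ^+ 2 / e * zpart (fun k => c k ^+ 2) N) +
      ln (e ^+ 3 / (4 * pi)) *+ (2 * N + 1)) <= e * ln (p e) by rewrite ler_pM2l.
    have -> : e * (- ((z0 / S) ^+ 2 / e * zpart (fun k => c k ^+ 2) N) +
        ln (e ^+ 3 / (4 * pi)) *+ (2 * N + 1)) =
      - ((z0 / S) ^+ 2 * zpart (fun k => c k ^+ 2) N) -
        (2 * N + 1)%:R * e * (- ln (e ^+ 3 / (4 * pi))).
      rewrite -[ln _ *+ _]mulr_natl; move: (ln _) ((2 * N + 1)%:R : R) (zpart _ _) => l m zz.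
      by have := S_gt0; move: S => s s0; field; rewrite !gt_eqF.
    (* Truncation only lowers the Gaussian cost, so the error in the lower bound comes from the
       windows alone; it is of order [tenth e ^+ 4]. *)
    have : (z0 / S) ^+ 2 * zpart (fun k => c k ^+ 2) N <= (z0 / S) ^+ 2 * S.
      by rewrite ler_wpM2l.
    have : (2 * N + 1)%:R * e * (- ln (e ^+ 3 / (4 * pi))) <= C * tenth e.
      have lk := ln_kappa_ge e0 w1.
      apply: (@le_trans _ _ (3 * tenth e ^+ 5 * ((4 * pi + 30) / tenth e))).
        apply: (@le_trans _ _ ((2 * N + 1)%:R * e * ((4 * pi + 30) / tenth e))).
          by rewrite ler_wpM2l// mulr_ge0// ltW.
        by rewrite ler_wpM2r// divr_ge0// ?(ltW w0)// addr_ge0// mulr_ge0// pi_ge0.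
      have -> : 3 * tenth e ^+ 5 * ((4 * pi + 30) / tenth e) =
          3 * (4 * pi + 30) * tenth e ^+ 4.
        by move: (pi : R) => x; field; rewrite gt_eqF.
      apply: (@le_trans _ _ (3 * (4 * pi + 30) * tenth e)).
        by rewrite ler_wpM2l ?(wXle 1%N)// mulr_ge0// addr_ge0// mulr_ge0// pi_ge0.
      by rewrite ler_wpM2r ?(ltW w0)// lerDl mulr_ge0.
    lra.
  (* Upper bound: only the squares beyond the cutoff are lost, an error of order [tenth e ^+ 18]. *)
  have : e * ln (p e) <= e * (- ((z0 / S) ^+ 2 / e *
      zpart (fun k => c k ^+ 2) (Num.truncn (cutoff e)))) by rewrite ler_pM2l.
  have -> : e * (- ((z0 / S) ^+ 2 / e * zpart (fun k => c k ^+ 2) (Num.truncn (cutoff e)))) =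
      - ((z0 / S) ^+ 2 * zpart (fun k => c k ^+ 2) (Num.truncn (cutoff e))).
    move: (zpart _ _) => zz.
    by have := S_gt0; move: S => s s0; field; rewrite !gt_eqF.
  have : (z0 / S) ^+ 2 * (S - zpart (fun k => c k ^+ 2) (Num.truncn (cutoff e))) <=
      (z0 / S) ^+ 2 * (T * (D * tenth e ^+ 9) ^+ 2) by rewrite ler_wpM2l// cutoff_tail.
  have -> : (z0 / S) ^+ 2 * (T * (D * tenth e ^+ 9) ^+ 2) = 4 * T * tenth e ^+ 18.
    rewrite /D; have := S_gt0; move: S T => s T' s0; field.
    by rewrite !gt_eqF.
  have : 4 * T * tenth e ^+ 18 <= C * tenth e.
    apply: (@le_trans _ _ (4 * T * tenth e)).
      by rewrite ler_wpM2l ?(wXle 1%N)// mulr_ge0.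
    have pi0 := pi_ge0 R; rewrite ler_wpM2r ?(ltW w0)// /C; lra.
  lra.
have cvg_ln : e * ln (p e) @[e --> (0 : R)^'+] --> - (z0 ^+ 2 / S).
  by apply: (@cvg_of_le_tenth _ _ _ C); apply: filterS bounds => e [].
apply: cvg_EFin.
  apply: filterS bounds => e [p0 _].
  by rewrite PE lne_EFin.
apply: cvg_trans cvg_ln; apply: near_eq_cvg.
apply: filterS bounds => e [p0 _] /=.
by rewrite PE lne_EFin.
Unshelve. all: by end_near. Qed.

(* exp(b m) dominates exp(b x / 2) plus a linear term, which makes the Gaussian
   tails at the thresholds below summable with a superexponentially small sum. *)
Let expR_split (x : R) (j m : nat) : 0 <= x -> x <= m%:R -> (j <= m)%N ->
  expR (b / 2 * x) + b / 2 * j%:R <= expR (b * m%:R).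
Proof.
move=> x0 xm jm; have b2 : 0 < b / 2 by rewrite divr_gt0.
have -> : b * m%:R = b / 2 * m%:R + b / 2 * m%:R by field.
rewrite expRD; set E := expR (b / 2 * m%:R).
have EZ : expR (b / 2 * x) <= E by rewrite ler_expR ler_pM2l.
have Z1 : 1 <= expR (b / 2 * x) by rewrite -[leLHS]expR0 ler_expR mulr_ge0// ltW.
have Ej : 1 + b / 2 * j%:R <= E.
  by apply: le_trans (expR_ge1Dx _); rewrite lerD2l ler_pM2l// ler_nat.
have j0 : 0 <= b / 2 * j%:R by rewrite mulr_ge0// ltW.
move: (expR (b / 2 * x)) E (b / 2 * j%:R) EZ Z1 Ej j0 => Z E u EZ Z1 Ej u0; nra.
Qed.

(** A compromise: radii below it leave terms [c k * r_k] of size at most [expR (- b * m / 2)], still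
    summable, while its square [expR (b * m) / a ^+ 2] makes exceeding it superexponentially
    rare. *)
Let threshold (m : nat) := expR (b / 2 * m%:R) / a.

Let large_mode (N j : nat) : set (param_space R) :=
  [set th | threshold (j + N.+1) <= ampl th (j + N.+1)%:Z] `|`
  [set th | threshold (j + N.+1) <= ampl th (- (j + N.+1)%:Z)].

Let measurable_large_mode N j : measurable (large_mode N j).
Proof. by apply: measurableU; apply: measurable_le_set => //; exact: measurable_ampl. Qed.

Let rho := expR (- (b / (2 * a ^+ 2))).

(** Dividing [expR_split] by [a ^+ 2] separates the exponent into a part free of [j] and a linear
    part, which becomes the geometric factor [rho ^+ j]; the factor 2 counts the two signs of the
    frequency. *)
Let prob_large_mode (x : R) N j : 0 <= x -> x <= N.+1%:R ->
  (P (large_mode N j) <= (2 * expR (- (expR (b / 2 * x) / a ^+ 2)) * rho ^+ j)%:E)%E.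
Proof.
move=> x0 xN; have th0 : 0 <= threshold (j + N.+1).
  by rewrite divr_ge0 ?expR_ge0// ltW.
apply: (@le_trans _ _ (P [set th | (threshold (j + N.+1) <= ampl th (j + N.+1)%:Z)%R] +
    P [set th | (threshold (j + N.+1) <= ampl th (- (j + N.+1)%:Z))%R])%E).
  by apply: measureU2; apply: measurable_le_set => //; exact: measurable_ampl.
rewrite !prob_ampl_tail// -EFinD lee_fin.
have double (u : R) : u + u = 2 * u by rewrite mulr_natl mulr2n.
rewrite double -mulrA ler_pM2l// -expRM_natr -expRD ler_expR.
have -> : threshold (j + N.+1) ^+ 2 = expR (b * (j + N.+1)%:R) / a ^+ 2.
  by rewrite /threshold expr_div_n -expRM_natr; congr (expR _ / _); field.
rewrite mulNr -opprD lerN2.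
have -> : expR (b / 2 * x) / a ^+ 2 + b / (2 * a ^+ 2) * j%:R =
    (expR (b / 2 * x) + b / 2 * j%:R) / a ^+ 2.
  by move: (expR _) => Z; field; rewrite gt_eqF.
rewrite ler_pM2r ?invr_gt0 ?exprn_gt0// expR_split// ?leq_addr//.
by rewrite (le_trans xN)// ler_nat leq_addl.
Qed.

Let tail_of_small_modes (th : param_space R) N : paramH th ->
  (forall j, ~ large_mode N j th) -> forall m, (N <= m)%N ->
  zpart (fun k => `|c k * ampl th k|) m - zpart (fun k => `|c k * ampl th k|) N
    <= 2 * 1 * expR (- (b / 2)) ^+ N.+1 / (1 - expR (- (b / 2))).
Proof.
move=> Hth small m Nm; apply: geometric_tail => //.
  by apply: expRN_01; rewrite divr_gt0.
move=> k Nk; have r0 : 0 <= ampl th k by have [] := Hth k.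
rewrite mul1r ger0_norm ?mulr_ge0 ?(ltW (c_gt0 k))//.
have rk : ampl th k <= threshold (absz k).
  have /not_orP[] := small (absz k - N.+1)%N.
  rewrite !subnK//= => /negP; rewrite -ltNge => h1 /negP; rewrite -ltNge => h2.
  by case: (intP k) r0 Nk h1 h2 => [|i|i] *; rewrite ?abszN; exact: ltW.
apply: le_trans (ler_pM _ _ (c_le k) rk) _ => //; first exact: ltW.
rewrite /threshold -!expRM_natr.
have -> : a * expR (- b * (absz k)%:R) * (expR (b / 2 * (absz k)%:R) / a) =
   expR (- b * (absz k)%:R) * expR (b / 2 * (absz k)%:R).
  by move: (expR _) (expR _) => u v; field; rewrite gt_eqF.
by rewrite -expRD le_eqVlt; apply/orP; left; apply/eqP; congr expR; field.
Qed.

(** The bound [expR u >= u ^+ 3 / 6] at [u = b / 2 * e ^ (- 1 / 2)] turns the exponential into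
    [e ^ (3 / 2)], which is [tenth e ^+ 15] and negligible against [e]; here [48 = 6 * 2 ^+ 3]. *)
Let small_tail e : 0 < e ->
  2 * 1 * expR (- (b / 2)) ^+ (Num.truncn (e `^ (- (1 / 2)))).+1 / (1 - expR (- (b / 2)))
  <= 96 / (b ^+ 3 * (1 - expR (- (b / 2)))) * tenth e ^+ 15.
Proof.
move=> e0; have w0 := tenth_gt0 e0; set N := Num.truncn _.
have b2 : 0 < b / 2 by rewrite divr_gt0.
have /andP[_ q1] := expRN_01 b2; rewrite -subr_gt0 in q1.
have -> : 96 / (b ^+ 3 * (1 - expR (- (b / 2)))) * tenth e ^+ 15 =
    2 * 1 * (48 / b ^+ 3 * tenth e ^+ 15) / (1 - expR (- (b / 2))).
  by move: (1 - _) q1 => z q1; field; rewrite !gt_eqF.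
rewrite ler_pM2r ?invr_gt0// ler_pM2l//.
apply: (@le_trans _ _ (expR (- (b / 2 * e `^ (- (1 / 2)))))).
  rewrite -expRM_natr ler_expR mulNr lerN2 ler_pM2l// ltW//; exact: truncnS_gt.
rewrite powR_Nhalf expRN.
have -> : 48 / b ^+ 3 * tenth e ^+ 15 = ((b / 2 / tenth e ^+ 5) ^+ 3 / 6)^-1.
  by field; rewrite !gt_eqF.
have u0 : 0 < b / 2 / tenth e ^+ 5 by rewrite divr_gt0// exprn_gt0.
rewrite lef_pV2 ?posrE ?expR_gt0 ?divr_gt0 ?exprn_gt0//.
by apply: le_trans (expR_ge1Dxn 2 (ltW u0)); rewrite lerDr.
Qed.

(** By contraposition: without a large mode the tail is tiny, and [calD_of_near_minimizer] applies
    with radii controlled up to the cutoff and phases up to [e ^ (- 1 / 2)]. *)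
Let calU_sub e : 0 < e -> tenth e <= 1 -> D * tenth e <= 1 ->
  (`|ln D| + 9) / b * tenth e <= 1 ->
  2 * (z0 / 2 + z0 * T * D ^+ 2 / S + 96 / (b ^+ 3 * (1 - expR (- (b / 2))))) * tenth e <= 1 ->
  calU c b z0 t e `\` calD c t (z0 * e `^ (- (1 / 2)) - e)%R `<=`
  \bigcup_j large_mode (Num.truncn (e `^ (- (1 / 2)))) j.
Proof.
move=> e0 w1 Dw cw Cw th [Uth nD]; apply: contrapT => nF; apply: nD.
have w0 := tenth_gt0 e0; set X := e `^ (- (1 / 2)) in nF *.
have small j : ~ large_mode (Num.truncn X) j th by move=> h; apply: nF; exists j.
have [Hth _ pth] := Uth.
have wXle i j : (i <= j)%N -> tenth e ^+ j <= tenth e ^+ i.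
  by move=> ij; apply: ler_wiXn2l => //; rewrite ltW.
have D9 : D * tenth e ^+ 9 <= 1.
  by apply: le_trans Dw; rewrite ler_pM2l// (wXle 1%N).
have K0 := cutoff_ge0 e0 D9.
have X0 : 0 <= X by rewrite powR_ge0.
have e1 : 0 <= e <= 1 by rewrite ltW//= -(tenthX10 e0) (wXle 0%N).
apply: (calD_of_near_minimizer _ e1 _ Hth _ _ _ (tail_of_small_modes Hth small)
  (rs := ampl_star c z0 e) (n := Num.truncn (cutoff e))) => //.
- by move=> k; exact: ltW.
- by apply: le_truncn; exact: cutoff_le.
- by apply: ampl_star_ge0 => // j; exact: ltW.
- by move=> k; exact: cutoff_mem.
- move=> k kN k0 k1; apply: pth => //.
  by rewrite -abszE -pmulrn -truncn_ge_nat.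
have -> : zpart (fun k => c k * ampl_star c z0 e k) (Num.truncn (cutoff e)) =
    z0 * X * (zpart (fun k => c k ^+ 2) (Num.truncn (cutoff e)) / S).
  rewrite mulrA mulrAC -zpartZ; congr zpart; apply/funext => k.
  by rewrite /ampl_star -/S -/X; field; rewrite gt_eqF.
have g1 : 1 - T * D ^+ 2 / S * tenth e ^+ 18 <=
    zpart (fun k => c k ^+ 2) (Num.truncn (cutoff e)) / S.
  rewrite ler_pdivlMr// mulrBl mul1r.
  have -> : T * D ^+ 2 / S * tenth e ^+ 18 * S = T * (D * tenth e ^+ 9) ^+ 2.
    by have := S_gt0; move: S T D => s T' D' s0; field; rewrite gt_eqF.
  by have := cutoff_tail e0; lra.
move: (zpart _ _ / S) g1 => g g1.
have := small_tail e0; rewrite -/X.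
move: (2 * 1 * _ / _) => d dle.
have XE : X = (tenth e ^+ 5)^-1 by exact: powR_Nhalf.
have beta0 : 0 <= T * D ^+ 2 / S.
  by rewrite divr_ge0 ?(ltW S_gt0)// mulr_ge0// sqr_ge0.
have gam0 : 0 <= 96 / (b ^+ 3 * (1 - expR (- (b / 2)))).
  have b2 : 0 < b / 2 by rewrite divr_gt0.
  have /andP[_ q1] := expRN_01 b2; rewrite -subr_gt0 in q1.
  by rewrite divr_ge0// mulr_ge0 ?(ltW q1)// exprn_ge0// ltW.
move: Cw; have -> : z0 * T * D ^+ 2 / S = z0 * (T * D ^+ 2 / S) by rewrite !mulrA.
move: (T * D ^+ 2 / S) (96 / _) beta0 gam0 g1 dle => beta gam beta0 gam0 g1 dle Cw.
have h1 : z0 * X * (1 - e ^+ 2 / 2 - beta * tenth e ^+ 18) <= (1 - e ^+ 2 / 2) * (z0 * X * g).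
  rewrite [leRHS]mulrCA ler_wpM2l ?mulr_ge0 ?(ltW z0_gt0)//.
  have : e ^+ 2 <= 1 by have /andP[? ?] := e1; rewrite exprn_ile1.
  have := sqr_ge0 e; move: (e ^+ 2) => e2 e20 e21.
  have : 0 <= beta * tenth e ^+ 18 by rewrite mulr_ge0// exprn_ge0// ltW.
  move: g1; move: (beta * _) => x g1 x0; nra.
(* The phase error and the truncation error, multiplied by [X] of order [tenth e ^- 5], become the
   powers 15 and 13, both beyond the tenth power that equals [e]. *)
have h2 : z0 * X * (1 - e ^+ 2 / 2 - beta * tenth e ^+ 18) =
    z0 * X - (z0 / 2 * tenth e ^+ 15 + z0 * beta * tenth e ^+ 13).
  by rewrite -{1}(tenthX10 e0) XE; field; rewrite gt_eqF.
have h3 : z0 / 2 * tenth e ^+ 15 + z0 * beta * tenth e ^+ 13 + gam * tenth e ^+ 15 <=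
   (z0 / 2 + z0 * beta + gam) * tenth e ^+ 11.
  rewrite !mulrDl; apply: lerD; first apply: lerD; apply: ler_wpM2l => //; try exact: wXle.
    by rewrite divr_ge0// ltW.
  by rewrite mulr_ge0// ltW.
(* The total deficit uses only half of the allowance [e], which yields the strict inequality. *)
have h4 : (z0 / 2 + z0 * beta + gam) * tenth e ^+ 11 <= e / 2.
  rewrite -{2}(tenthX10 e0) [tenth e ^+ 11]exprS mulrA mulrC ler_wpM2l ?exprn_ge0 ?(ltW w0)//.
  lra.
lra.
Qed.

(** The union bound over large modes gives [2 * expR (- A) / (1 - rho)]; half of the exponent is
    sacrificed to absorb the constant, whence the factor [(2 * a ^+ 2)^-1]. *)
Lemma calU_D_superexponential : \forall e \near (0 : R)^'+,
  (lne (P (calU c b z0 t e `\` calD c t (z0 * e `^ (- (1 / 2)) - e)%R))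
       <= (- ((2 * a ^+ 2)^-1 * expR (b / 2 * e `^ (- (1 / 2)))))%:E)%E.
Proof.
have r01 : 0 <= rho < 1 by apply: expRN_01; rewrite divr_gt0 ?mulr_gt0 ?exprn_gt0.
have /andP[_ r1] := r01; rewrite -subr_gt0 in r1.
near=> e.
have e0 : 0 < e by near: e; exact: nbhs_right_gt.
have w0 := tenth_gt0 e0.
have w1 : 1 * tenth e <= 1 by near: e; exact: near_tenth_small.
rewrite mul1r in w1.
have Mw : 2 / (1 - rho) * (4 * a ^+ 2 / b) * tenth e <= 1.
  by near: e; exact: near_tenth_small.
set X := e `^ (- (1 / 2)); set A := expR (b / 2 * X) / a ^+ 2.
have X0 : 0 <= X by rewrite powR_ge0.
have mUD : measurable (calU c b z0 t e `\` calD c t (z0 * X - e)%R).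
  by apply: measurableD; [exact: measurable_calU|exact: measurable_calD].
have le1 : (P (calU c b z0 t e `\` calD c t (z0 * X - e)%R) <=
    (2 * expR (- A) / (1 - rho))%:E)%E.
  apply: (prob_bigcup_geometric r01 mUD (measurable_large_mode _) _ _) => [|j].
    apply: calU_sub => //.
    - by near: e; exact: near_tenth_small.
    - by near: e; exact: near_tenth_small.
    - by near: e; exact: near_tenth_small.
  by apply: prob_large_mode => //; rewrite ltW//; exact: truncnS_gt.
have le2 : 2 * expR (- A) / (1 - rho) <= expR (- (A / 2)).
  (* Two applications of [expR y >= 1 + y] reduce this to a linear lower bound on [X]. *)
  have key : 2 / (1 - rho) <= expR (A / 2).
    apply: le_trans (expR_ge1Dx _); apply: (@le_trans _ _ (A / 2)); last by rewrite lerDr.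
    apply: (@le_trans _ _ (b / 2 * X / a ^+ 2 / 2)); last first.
      rewrite ler_pM2r ?invr_gt0// ler_pM2r ?invr_gt0 ?exprn_gt0//.
      by apply: le_trans (expR_ge1Dx _); rewrite lerDr.
    have -> : b / 2 * X / a ^+ 2 / 2 = X / (4 * a ^+ 2 / b).
      by field; rewrite !gt_eqF.
    rewrite ler_pdivlMr ?divr_gt0 ?mulr_gt0 ?exprn_gt0//.
    rewrite /X powR_Nhalf; apply: (@le_trans _ _ (tenth e)^-1).
      by rewrite -[leRHS]div1r ler_pdivlMr.
    rewrite lef_pV2 ?posrE ?exprn_gt0//.
    by rewrite -[leRHS]expr1 ler_wiXn2l// ltW.
  have -> : expR (- A) = expR (- (A / 2)) * expR (- (A / 2)).
    by rewrite -expRD; congr expR; field.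
  have -> : 2 * (expR (- (A / 2)) * expR (- (A / 2))) / (1 - rho) =
    expR (- (A / 2)) * (2 / (1 - rho) * expR (- (A / 2))).
    by move: (expR _) => u; field; rewrite gt_eqF.
  by rewrite ler_piMr ?expR_ge0// expRN ler_pdivrMr ?expR_gt0// mul1r.
have -> : (- ((2 * a ^+ 2)^-1 * expR (b / 2 * X)))%:E = lne (expR (- (A / 2)))%:E.
  rewrite lne_EFin ?expR_gt0// expRK; congr (_%:E).
  by rewrite /A; move: (expR _) => Z; field; rewrite gt_eqF.
rewrite lee_lne ?in_itv/= ?measure_ge0 ?lee_fin ?expR_ge0 ?leey//.
by apply: le_trans le1 _; rewrite lee_fin.
Unshelve. all: by end_near. Qed.

End Asymptotics.

(** * Conclusion for exponential and Gaussian coefficients *)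

Theorem theorem1p9 (R : realType) (P : probability (param_space R) R)
  (hP : param_law P)
  (a b : R) (ha : 0 < a) (hb : 0 < b)
  (c : int -> R)
  (hc : (forall k : int, c k = a * expR (- b * `|k|%:~R)) \/
        (forall k : int, c k = a * expR (- b * (`|k|%:~R) ^+ 2)))
  (z0 t : R) (hz0 : 0 < z0) (ht : 0 < t) :
  ((e%:E * lne (P (calU c b z0 t e)))%E @[e --> (0 : R)^'+]
     --> (- (z0 ^+ 2 / zsum (fun k => c k ^+ 2)))%:E)
  /\
  exists c1 C1 e0 : R, [/\ 0 < c1, 0 < C1, 0 < e0 &
    forall e : R, 0 < e < e0 ->
      (lne (P (calU c b z0 t e `\` calD c t (z0 * e `^ (- (1 / 2)) - e)%R))
       <= (- (C1 * expR (c1 * e `^ (- (1 / 2)))))%:E)%E].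
Proof.
have c_gt0 k : 0 < c k by case: hc => ->; rewrite mulr_gt0// expR_gt0.
(* For an integer, [|k| <= |k| ^+ 2], so the Gaussian coefficients obey the same geometric bound and
   both cases are treated at once. *)
have c_le k : c k <= a * expR (- b) ^+ absz k.
  rewrite -expRM_natr; case: hc => ->; rewrite -abszE -pmulrn ler_pM2l// ler_expR//.
  rewrite !mulNr lerN2 ler_pM2l// -natrX ler_nat.
  by case: (absz k) => // n; rewrite -[leqLHS]expn1 leq_pexp2l.
split; first exact: (ldp_calU t ha hb hz0 c_gt0 c_le hP).
have [e0 e0_gt0 he] := near_right0P (calU_D_superexponential t ha hb hz0 c_gt0 c_le hP).
exists (b / 2), (2 * a ^+ 2)^-1, e0; split=> //.
- by rewrite divr_gt0.
- by rewrite invr_gt0 mulr_gt0// exprn_gt0.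
Qed.
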